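(* Let $R=\prod_{i\in\mathcal{A}}R_i/N_iR_i$, where $\mathcal{A}$ is an infinite set, each $R_i$ is a principal ideal domain and $N_i\in R_i$ is not a unit (possibly $N_i=0$). Let $S=R[x_1,\dots,x_n]$ and let $M$ be a finitely generated $S$-module. Suppose $M\cong F/U$, where $F=\bigoplus_{i=1}^rS$ is a finitely generated free $S$-module and $U\subseteq F$ is a submodule such that, for some monomial order on $F$, the $S$-module $\operatorname{LT}(U)$ is finitely generated. Then $M$ admits a free $S$-resolution $$\dots\to F_p\to F_p\to F_p\to F_{p-1}\to\dots\to F_1\to F_0\to M\to 0,$$ where $p\le n+1$; that is, an exact sequence of free $S$-modules in which the module in every homological degree $\ge p$ is $F_p$ (the maps may vary).
   Context: Let $e_1,\dots,e_r$ be the standard basis of $F$. A monomial of $F$ is an element $ue_i$ with $u$ a monomial of $S$. A monomial order on $F$ is a total order $>$ on the monomials of $F$ such that $wm>m$ for every monomial $m$ of $F$ and every monomial $w\ne1$ of $S$, and such that $m>m'$ implies $wm>wm'$ for every monomial $w$ of $S$. For $0\neq f\in F$ whose largest monomial is $ue_i$, with coefficient $a\neq 0$, the leading term is $\operatorname{LT}(f)=aue_i$; also $\operatorname{LT}(0)=0$. $\operatorname{LT}(U)$ is the $S$-submodule of $F$ generated by the leading terms of the elements of $U$. *)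

(* Defs.v *)
From HB Require Import structures.
From mathcomp Require Import all_boot all_order all_algebra.
From mathcomp Require Import boolp classical_sets cardinality.
From mathcomp Require Import mpoly.

Set Implicit Arguments.
Unset Strict Implicit.
Unset Printing Implicit Defensive.
Import Order.TTheory GRing.Theory.
Import Quotient.
Local Open Scope ring_scope.
Local Open Scope quotient_scope.
Local Open Scope classical_set_scope.

Section Submodules.
Variables (S : nzRingType) (V : lmodType S).

Definition is_submodule (N : set V) : Prop :=
  N 0 /\ forall (a : S) (u v : V), N u -> N v -> N (a *: u + v).

Definition submodule_gen (X : set V) : set V := smallest is_submodule X.

Definition fin_gen (N : set V) : Prop :=
  exists s : seq V, N = submodule_gen [set x | x \in s].

End Submodules.

Definition is_pid (D : idomainType) : Prop :=
  forall I : set D^o, is_submodule I -> exists a : D^o, I = submodule_gen [set a].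

Section QuotientRing.
Variables (D : idomainType) (N : D) (hN : N \isn't a GRing.unit).

(* The proof hN is a parameter because mathcomp ideals are proper by definition
   (the quotient must be a nontrivial ring). *)
Definition pr_ideal & N \isn't a GRing.unit : {pred D} :=
  fun x => `[< exists y, x = N * y >].

Fact pr_ideal_closed : idealr_closed (pr_ideal hN).
Proof.
split; first by apply/asboolP; exists 0; rewrite mulr0.
  apply/asboolP => -[y Ny]; move: hN; rewrite unitrE => /negP; apply.
  have uN : N \is a GRing.unit by apply/unitrPr; exists y.
  by rewrite divrr.
move=> a x z /asboolP[y ->] /asboolP[t ->]; apply/asboolP.
by exists (a * y + t); rewrite mulrDr mulrCA.
Qed.

HB.instance Definition _ := isIdealr.Build D (pr_ideal hN) pr_ideal_closed.

Definition quot_ring : comNzRingType := {ideal_quot (pr_ideal hN)}.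

End QuotientRing.

Section ProductRing.
Variables (A : Type) (infA : infinite_set [set: A]) (Q : A -> comNzRingType).

(* infA guarantees a nonempty index set, hence a nontrivial product ring. *)
Definition prod_carrier & infinite_set [set: A] : Type := forall i, Q i.

Local Notation P := (prod_carrier infA).

HB.instance Definition _ := Choice.copy P (forall i, Q i).

Definition prod_zero : P := fun=> 0.
Definition prod_one : P := fun=> 1.
Definition prod_opp (f : P) : P := fun i => - f i.
Definition prod_add (f g : P) : P := fun i => f i + g i.
Definition prod_mul (f g : P) : P := fun i => f i * g i.

Fact prod_ext (f g : P) : (forall i, f i = g i) -> f = g.
Proof. exact: functional_extensionality_dep. Qed.

Local Ltac pointwise t := move=> *; apply: prod_ext => i; exact: t.

Fact prod_addA : associative prod_add. Proof. pointwise addrA. Qed.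
Fact prod_addC : commutative prod_add. Proof. pointwise addrC. Qed.
Fact prod_add0 : left_id prod_zero prod_add. Proof. pointwise add0r. Qed.
Fact prod_addN : left_inverse prod_zero prod_opp prod_add.
Proof. pointwise addNr. Qed.

HB.instance Definition _ :=
  GRing.isZmodule.Build P prod_addA prod_addC prod_add0 prod_addN.

Fact prod_mulA : associative prod_mul. Proof. pointwise mulrA. Qed.
Fact prod_mulC : commutative prod_mul. Proof. pointwise mulrC. Qed.
Fact prod_mul1 : left_id prod_one prod_mul. Proof. pointwise mul1r. Qed.
Fact prod_mulD : left_distributive prod_mul (@GRing.add P).
Proof. pointwise mulrDl. Qed.
Fact prod_one_neq0 : prod_one != 0.
Proof.
have [i _] := infinite_setN0 infA; apply/eqP => /(congr1 (fun f : P => f i)).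
by apply/eqP/oner_neq0.
Qed.

HB.instance Definition _ := GRing.Zmodule_isComNzRing.Build P
  prod_mulA prod_mulC prod_mul1 prod_mulD prod_one_neq0.

Definition prod_ring : comNzRingType := P.

End ProductRing.

Section QuotientModule.
Variables (S : nzRingType) (V : lmodType S) (U : set V) (hU : is_submodule U).

Definition submod_pred & is_submodule U : {pred V} := fun x => `[< U x >].

Fact submod_predP (x : V) : reflect (U x) (x \in submod_pred hU).
Proof. exact: asboolP. Qed.

Fact submod_pred_closed : submod_closed (submod_pred hU).
Proof.
have [U0 UZD] := hU; split; first exact/submod_predP.
by move=> a u v /submod_predP Uu /submod_predP Uv; apply/submod_predP/UZD.
Qed.

HB.instance Definition _ := GRing.isSubmodClosed.Build S V (submod_pred hU)
  (GRing.submod_closed_semi submod_pred_closed).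

Definition quot_mod : Type := {quot (submod_pred hU)}.

HB.instance Definition _ := GRing.Zmodule.on quot_mod.

Local Notation Q := {quot (submod_pred hU)}.

Definition quot_scale (a : S) (x : quot_mod) : quot_mod :=
  \pi_Q (a *: repr x).

Fact pi_scale (a : S) (v : V) :
  quot_scale a (\pi_Q v) = \pi_Q (a *: v).
Proof.
rewrite /quot_scale; apply/eqP; rewrite -idealrBE -scalerBr rpredZ //.
by rewrite idealrBE reprK eqxx.
Qed.

Fact quot_mod_surj (x : quot_mod) : exists v, x = \pi_Q v.
Proof. by exists (repr x); rewrite reprK. Qed.

Fact pi_add (u v : V) : (\pi_Q u + \pi_Q v : quot_mod) = \pi_Q (u + v).
Proof. by rewrite -[LHS]/(\pi_Q u + \pi_Q v) -raddfD. Qed.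

Fact quot_scaleA (a b : S) (x : quot_mod) :
  quot_scale a (quot_scale b x) = quot_scale (a * b) x.
Proof. by have [v ->] := quot_mod_surj x; rewrite !pi_scale scalerA. Qed.

Fact quot_scale1 : left_id 1 quot_scale.
Proof. by move=> x; have [v ->] := quot_mod_surj x; rewrite pi_scale scale1r. Qed.

Fact quot_scaleDr : right_distributive quot_scale +%R.
Proof.
move=> a x y; have [u ->] := quot_mod_surj x; have [v ->] := quot_mod_surj y.
by rewrite pi_add !pi_scale scalerDr -pi_add.
Qed.

Fact quot_scaleDl (x : quot_mod) : {morph quot_scale^~ x : a b / a + b}.
Proof.
by move=> a b; have [v ->] := quot_mod_surj x; rewrite !pi_scale scalerDl pi_add.
Qed.

HB.instance Definition _ := GRing.Zmodule_isLmodule.Build S quot_mod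
  quot_scaleA quot_scale1 quot_scaleDr quot_scaleDl.

End QuotientModule.

Section LeadingTerms.
Variables (R : comNzRingType) (n r : nat).

Local Notation S := {mpoly R[n]}.
Local Notation F := 'rV[S]_r.

(* (u, i) stands for the monomial u e_i of F. *)
Definition fmonom : Type := 'X_{1..n} * 'I_r.

Definition fmonom_mul (w : 'X_{1..n}) (m : fmonom) : fmonom :=
  ((w + m.1)%MM, m.2).

Definition monomial_order (gt : rel fmonom) : Prop :=
  [/\ irreflexive gt, transitive gt & forall m m', m != m' -> gt m m' || gt m' m]
  /\ [/\ forall w m, w != 0%MM -> gt (fmonom_mul w m) m
       & forall w m m', gt m m' -> gt (fmonom_mul w m) (fmonom_mul w m')].

Definition fcoeff (f : F) (m : fmonom) : R := (f ord0 m.2)@_m.1.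

Definition fterm (a : R) (m : fmonom) : F := (a *: 'X_[m.1]) *: delta_mx ord0 m.2.

Definition fsupp (f : F) : seq fmonom :=
  [seq (u, i) | i <- enum 'I_r, u <- msupp (f ord0 i)].

Variable gt : rel fmonom.

Definition lead_monom (f : F) : option fmonom :=
  ohead [seq m <- fsupp f | all (fun m' => (m' == m) || gt m m') (fsupp f)].

(* The support is empty exactly when f = 0. *)
Definition LT (f : F) : F :=
  if lead_monom f is Some m then fterm (fcoeff f m) m else 0.

Definition LT_submodule (U : set F) : set F := submodule_gen (LT @` U).

End LeadingTerms.

Section Resolutions.
Variables (S : comNzRingType) (M : lmodType S).

(* An exact sequence ... -> F_2 -> F_1 -> F_0 -> M -> 0 with F_j = S^(b j) and
   F_j = F_p for all j >= p; d j is the map F_(j+1) -> F_j.  The free modules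
   have finite rank: with arbitrary ranks, adding trivial summands of a large
   infinite rank would yield such a sequence with p = 0 for every module. *)
Definition free_resolution_stable_from (p : nat) : Prop :=
  exists (b : nat -> nat) (e : {linear 'rV[S]_(b 0) -> M})
         (d : forall j, {linear 'rV[S]_(b j.+1) -> 'rV[S]_(b j)}),
    [/\ forall j, (p <= j)%N -> b j = b p,
        range e = [set: M],
        range (d 0%N) = [set x | e x = 0]
      & forall j, range (d j.+1) = [set x | d j x = 0]].

End Resolutions.

(* Main.v *)
Require Import Defs.
From HB Require Import structures.
From mathcomp Require Import all_boot all_order all_algebra.
From mathcomp Require Import boolp classical_sets cardinality.
From mathcomp Require Import mpoly.
From mathcomp Require Import zify ring.

(** Two properties of the coefficient ring R carry the proof: finitely generated
    ideals are principal, and so are annihilators of elements.  Both hold in a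
    quotient of a principal ideal domain by an element and pass to products
    (quot_ring_bezout, quot_ring_annihilators, prod_ring_bezout,
    prod_ring_annihilators).

    Since LT(U) is finitely generated, the exponents of its generators are
    bounded by some D, and the ideal of leading coefficients of U at the monomial
    x^w e_i depends only on (i, min(w, D)); it is generated by one element
    a(i, min(w, D)) (groebner_data).  A cell is a pair k = (i, v) with v in the
    box [0, D]^n, and the variables x_q with v_q < D are free at k.  Hence LT(U)
    has a filtration with one piece for each cell, namely the multiples of
    a(k) x^v e_i by polynomials in the variables that are not free at k; the free
    variables move a monomial to another cell, so they act by zero on the piece.
    Put c_0 = a(k) and let c_(t+1) generate the annihilator of c_t: this gives a
    resolution of the ideal (a(k)) by copies of R, and tensoring it with the Koszul
    complex of the free variables resolves the piece.  The sum over the cells has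
    in position s a basis of pairs (k, T), where T is a set of at most s free
    variables at k; the remaining degree s - #T is the position in the sequence c.
    These index sets stop growing at s = n, which gives p = n + 1, because F itself
    comes before position 0.

    The resolution of F/U is a deformation of this complex, continued by F.  Monomials get
    weights, namely the monomial of F to which they contribute, and, to separate
    the cells that contribute to one monomial, the level sum_q (D - v_q).  Weights
    are well ordered by Dickson's lemma (monomial_order_wf, wlt_wf).  The first
    map sends the basis element of the cell (i, v) to an element of U with
    leading term a(i, v) x^v e_i; each later differential is the differential of
    that complex, here called the symbol, plus terms of smaller weight.
    Every kernel is hit in a weight-preserving way (strict_onto): the symbols are
    exact in each weight (symbol_exact), so the top part of a cycle can be
    cancelled, and well-founded induction finishes (strict_onto_of_lead).
    Strictness of one map is in turn what allows the next symbol to be corrected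
    to a map into its kernel (good_stage_succ). *)

Set Implicit Arguments.
Unset Strict Implicit.
Unset Printing Implicit Defensive.
Import GRing.Theory.
Local Open Scope ring_scope.

(** * Monomial orders are well founded *)

Section WellFoundedness.

Lemma ex_later_min (h : nat -> nat) (m : nat) :
  exists p, (m < p)%N /\ forall q, (m < q)%N -> (h p <= h q)%N.
Proof.
have ex : exists v, `[< exists2 p, (m < p)%N & h p = v >].
  by exists (h m.+1); apply/asboolP; exists m.+1.
have [v /asboolP[p mp <-] vmin] := ex_minnP ex.
by exists p; split=> // q mq; apply: vmin; apply/asboolP; exists q.
Qed.

Lemma homo_iter_lt (phi : nat -> nat) :
  (forall k, phi k < phi k.+1)%N -> forall i j, (i < j)%N -> (phi i < phi j)%N.
Proof. by move=> inc i j; apply: (homo_ltn ltn_trans inc). Qed.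

Lemma nondecreasing_subseq (h : nat -> nat) :
  exists2 phi : nat -> nat, forall k, (phi k < phi k.+1)%N &
    forall k, (h (phi k) <= h (phi k.+1))%N.
Proof.
have [nxt nxtP] := choice (ex_later_min h).
exists (fun k => iter k.+1 nxt 0%N) => k; first by case: (nxtP (iter k.+1 nxt 0%N)).
have [lt1 le1] := nxtP (iter k nxt 0%N).
have [lt2 _] := nxtP (iter k.+1 nxt 0%N).
by rewrite [in X in (X <= _)%N]iterS; apply: le1; apply: ltn_trans lt2.
Qed.

(** Finitely many sequences of naturals are nondecreasing along a common
    subsequence: extract one sequence after the other. *)
Lemma common_nondecreasing_subseq (hs : seq (nat -> nat)) :
  exists2 phi : nat -> nat, forall k, (phi k < phi k.+1)%N &
    forall i, (i < size hs)%N ->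
    forall k, (nth id hs i (phi k) <= nth id hs i (phi k.+1))%N.
Proof.
elim: hs => [|h hs [phi inc mono]]; first by exists id.
have [psi incp monop] := nondecreasing_subseq (h \o phi).
exists (phi \o psi) => [k|[_|i] /=]; first exact/(homo_iter_lt inc)/incp.
  exact: monop.
rewrite ltnS => /mono mi k.
apply: (homo_leq (f := fun k => nth id hs i (phi k)) (r := leq)) => //.
  by move=> y x z; apply: leq_trans.
exact/ltnW/incp.
Qed.

Lemma no_descent_wf (T : Type) (lt : T -> T -> Prop) :
  (forall f : nat -> T, (forall k, lt (f k.+1) (f k)) -> False) ->
  well_founded lt.
Proof.
move=> no_desc x; apply: contrapT => nAx.
pose B := {y | ~ Acc lt y}.
have nxt (y : B) : exists z : B, lt (sval z) (sval y).
  case: y => y nAy /=; apply: contrapT => no; apply: nAy; constructor => z lzy.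
  by apply: contrapT => nAz; apply: no; exists (exist _ z nAz).
have [f fP] := choice nxt.
by apply: (no_desc (fun k => sval (iter k f (exist _ x nAx)))) => k; exact: fP.
Qed.

Variables (n r : nat) (gt : rel (fmonom n r)).
Hypothesis gt_order : monomial_order gt.

(** Dickson's lemma is what makes descending chains stop: a sequence of
    monomials has a subsequence that increases for divisibility, and a multiple
    of a monomial is never smaller than it. *)
Lemma monomial_order_wf : well_founded (fun m m' => gt m' m).
Proof.
have [[irr tr _] [mulgt _]] := gt_order.
apply: no_descent_wf => f desc.
(* Both the index i of e_i and r - i are made nondecreasing, which forces the
   index to be constant. *)
pose hs : seq (nat -> nat) := [:: (fun k => (f k).2 : nat), (fun k => r - (f k).2)%N &
   [seq (fun k => (f k).1 q) | q <- enum 'I_n]].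
have [phi inc mono] := common_nondecreasing_subseq hs.
have desclt i j : (i < j)%N -> gt (f i) (f j).
  by apply: (homo_ltn (f := f) (r := gt)) => // y x z; apply: tr.
have gt01 := desclt _ _ (inc 0%N).
have e2 : (f (phi 0%N)).2 = (f (phi 1%N)).2.
  have /= le_i := mono 0%N isT 0%N; have /= ge_i := mono 1%N isT 0%N.
  apply: val_inj => /=.
  move: le_i ge_i (ltn_ord (f (phi 0%N)).2) (ltn_ord (f (phi 1%N)).2); clear.
  by move: (f _).2 (f _).2 => [i /= _] [j /= _]; lia.
have le1 : ((f (phi 0%N)).1 <= (f (phi 1%N)).1)%MM.
  apply/mnm_lepP => q; have := mono q.+2; rewrite /= size_map size_enum_ord.
  move=> /(_ (ltn_ord q) 0%N); rewrite (nth_map q) ?size_enum_ord //.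
  by rewrite nth_ord_enum.
have fE : f (phi 1%N) = fmonom_mul ((f (phi 1%N)).1 - (f (phi 0%N)).1)%MM (f (phi 0%N)).
  by rewrite /fmonom_mul submK // e2 -surjective_pairing.
move: fE; have [-> fE|n0 fE] := eqVneq ((f (phi 1%N)).1 - (f (phi 0%N)).1)%MM 0%MM.
  by move: gt01; rewrite fE /fmonom_mul add0m -surjective_pairing irr.
by have := mulgt _ (f (phi 0%N)) n0; rewrite -fE => /(tr _ _ _ gt01); rewrite irr.
Qed.

(** The level separates the basis elements that contribute to the same monomial
    of F. *)
Definition weight : Type := fmonom n r * nat.

Definition wlt (a b : weight) : Prop := gt b.1 a.1 \/ a.1 = b.1 /\ (a.2 < b.2)%N.

Definition wle (a b : weight) : Prop := wlt a b \/ a = b.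

Definition wmul (v : 'X_{1..n}) (a : weight) : weight := (fmonom_mul v a.1, a.2).

Lemma wlt_wf : well_founded wlt.
Proof.
move=> [m l]; elim/(well_founded_ind monomial_order_wf): m l => m IHm l.
elim/ltn_ind: l => l IHl; constructor => -[m' l'] [/= lt|[/= -> lt]].
  exact: IHm.
exact: IHl.
Qed.

Lemma wlt_trans b a c : wlt a b -> wlt b c -> wlt a c.
Proof.
have [[_ tr _] _] := gt_order; case: a b c => [a x] [b y] [c z] /=.
move=> [/= ab|[/= <- xy]] [/= bc|[/= <- yz]]; [left|left|left|right] => //=.
  exact: tr bc ab.
by split=> //; apply: ltn_trans yz.
Qed.

Lemma wlt_irr a : ~ wlt a a.
Proof. by have [[irr _ _] _] := gt_order; case; rewrite ?irr // ltnn => -[]. Qed.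

Lemma wle_lt_trans b a c : wle a b -> wlt b c -> wlt a c.
Proof. by move=> [ab|->] //; apply: wlt_trans. Qed.

Lemma wlt_le_trans b a c : wlt a b -> wle b c -> wlt a c.
Proof. by move=> ab [bc|<-] //; apply: wlt_trans bc. Qed.

Lemma wle_trans b a c : wle a b -> wle b c -> wle a c.
Proof. by move=> ab [bc|<- //]; left; apply: wle_lt_trans bc. Qed.

Lemma wltW a b : wlt a b -> wle a b. Proof. by left. Qed.

Lemma wle_refl a : wle a a. Proof. by right. Qed.

Lemma wle_total a b : wle a b \/ wlt b a.
Proof.
have [[_ _ tot] _] := gt_order; case: a b => [a x] [b y].
have [->|/tot/orP[|]] := eqVneq a b.
- have [xy|yx|->] := ltngtP x y; [left; left; right|right; right|left; right] => //.
- by right; left.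
- by left; left; left.
Qed.

Lemma wlt_mul v a b : wlt a b -> wlt (wmul v a) (wmul v b).
Proof.
have [_ [_ mulmono]] := gt_order; case=> [/(mulmono v) ab|[ab lt]]; first by left.
by right; rewrite /= ab.
Qed.

Lemma wle_mul v a b : wle a b -> wle (wmul v a) (wmul v b).
Proof. by case=> [/(@wlt_mul v)|->]; [left|right]. Qed.

End WellFoundedness.

(** * Filtrations of free modules by weights *)

Section Filtration.

Variables (R : comNzRingType) (n r : nat) (gt : rel (fmonom n r)).
Hypothesis gt_order : monomial_order gt.

Local Notation S := {mpoly R[n]}.
Local Notation weight := (weight n r).

Lemma mcoeffXM (v w : 'X_{1..n}) (p : S) :
  ('X_[v] * p)@_w = if (v <= w)%MM then p@_(w - v) else 0.
Proof.
rewrite mulrC; case: ifPn => [vw|nvw].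
  by rewrite -{1}(submK vw) addmC mcoeffMX.
apply/eqP; rewrite mcoeff_eq0 (perm_mem (msuppMX p v)).
by apply: contra nvw => /mapP[u _ ->]; exact: lem_addr.
Qed.

(** The basis element e_j of S^a stands in degree gdeg j, so that x^u e_j is seen
    at w = u + gdeg j and has weight gwt j w.  The inequality, instead of an
    equality, is there for F itself: there the level drops when a monomial grows
    inside the box. *)
Record grading (a : nat) := Grading {
  gdeg : 'I_a -> 'X_{1..n};
  gwt : 'I_a -> 'X_{1..n} -> weight;
  gwt_le : forall j v w, wle gt (gwt j (v + w)%MM) (wmul v (gwt j w)) }.

Definition homogeneous_wt a (G : grading a) :=
  forall j v w, gwt G j (v + w)%MM = wmul v (gwt G j w).

(** This is 0 unless gdeg j <= w. *)
Definition tcoef a (G : grading a) (f : 'rV[S]_a) j w : R :=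
  ('X_[gdeg G j] * f ord0 j)@_w.

(** With Q the weights below (or strictly below) some w, this is a step of the
    filtration of S^a by weight. *)
Definition fil a (G : grading a) (Q : weight -> Prop) (f : 'rV[S]_a) : Prop :=
  forall j w, tcoef G f j w != 0 -> Q (gwt G j w).

Section OneModule.
Variables (a : nat) (G : grading a).

Lemma tcoef0 j w : tcoef G 0 j w = 0.
Proof. by rewrite /tcoef mxE mulr0 mcoeff0. Qed.

Lemma tcoefD f h j w : tcoef G (f + h) j w = tcoef G f j w + tcoef G h j w.
Proof. by rewrite /tcoef mxE mulrDr mcoeffD. Qed.

Lemma tcoefB f h j w : tcoef G (f - h) j w = tcoef G f j w - tcoef G h j w.
Proof. by rewrite /tcoef !mxE mulrBr mcoeffB. Qed.

Lemma tcoefC c f j w : tcoef G (c%:MP *: f) j w = c * tcoef G f j w.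
Proof. by rewrite /tcoef mxE mulrCA mcoeffCM. Qed.

Lemma tcoef_eq0 f : (forall j w, tcoef G f j w = 0) -> f = 0.
Proof.
move=> f0; apply/rowP => j; rewrite mxE; apply/mpolyP => w.
have := f0 j (gdeg G j + w)%MM; rewrite /tcoef mcoeffXM lem_addr.
by rewrite addmC addmK mcoeff0.
Qed.

Lemma tcoefX v f j w : tcoef G ('X_[v] *: f) j w =
  if (v <= w)%MM then tcoef G f j (w - v)%MM else 0.
Proof. by rewrite /tcoef mxE mulrCA [LHS]mcoeffXM. Qed.

Lemma fil_sub (Q Q' : weight -> Prop) f :
  (forall w, Q w -> Q' w) -> fil G Q f -> fil G Q' f.
Proof. by move=> QQ' ff j w /ff/QQ'. Qed.

Lemma fil0 Q : fil G Q 0.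
Proof. by move=> j w; rewrite tcoef0 eqxx. Qed.

Lemma filD Q f h : fil G Q f -> fil G Q h -> fil G Q (f + h).
Proof.
move=> ff fh j w; rewrite tcoefD.
have [f0|/ff//] := eqVneq (tcoef G f j w) 0.
by rewrite f0 add0r => /fh.
Qed.

Lemma filC Q c f : fil G Q f -> fil G Q (c%:MP *: f).
Proof.
move=> ff j w; rewrite tcoefC => nz; apply: ff.
by apply: contraNneq nz => ->; rewrite mulr0.
Qed.

Lemma filB Q f h : fil G Q f -> fil G Q h -> fil G Q (f - h).
Proof.
move=> ff fh; apply: filD => //; rewrite -scaleN1r.
have -> : -1 = (-1)%:MP :> S by rewrite mpolyCN mpolyC1.
exact: filC.
Qed.

Lemma fil_sum Q I (s : seq I) (P : pred I) (F : I -> 'rV[S]_a) :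
  (forall i, P i -> fil G Q (F i)) -> fil G Q (\sum_(i <- s | P i) F i).
Proof.
move=> fF; elim/big_rec: _ => [|i f Pi]; first exact: fil0.
exact: filD (fF i Pi).
Qed.

Lemma fil_leX v w f : fil G (wle gt ^~ w) f -> fil G (wle gt ^~ (wmul v w)) ('X_[v] *: f).
Proof.
move=> ff j u; rewrite tcoefX; case: ifP => [vu|_]; last by rewrite eqxx.
move=> /ff le; rewrite -(submK vu) addmC.
exact: (wle_trans gt_order (gwt_le _ _ _ _) (wle_mul gt_order v le)).
Qed.

Lemma fil_ltX v w f : fil G (wlt gt ^~ w) f -> fil G (wlt gt ^~ (wmul v w)) ('X_[v] *: f).
Proof.
move=> ff j u; rewrite tcoefX; case: ifP => [vu|_]; last by rewrite eqxx.
move=> /ff le; rewrite -(submK vu) addmC.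
exact: (wle_lt_trans gt_order (gwt_le _ _ _ _) (wlt_mul gt_order v le)).
Qed.

Lemma fil_lt w f : fil G (wle gt ^~ w) f ->
  (forall j u, gwt G j u = w -> tcoef G f j u = 0) -> fil G (wlt gt ^~ w) f.
Proof. by move=> ff f0 j u nz; have [//|/f0 e] := ff _ _ nz; rewrite e eqxx in nz. Qed.

Lemma max_weight (s : seq ('X_{1..n} * 'I_r * nat)) : s != [::] ->
  exists2 w, w \in s & forall w', w' \in s -> wle gt w' w.
Proof.
elim: s => // x s IHs _; have [->|/IHs[w ws wmax]] := eqVneq s [::].
  by exists x => [|w]; rewrite inE // => /eqP ->; apply: wle_refl.
have [xw|wx] := wle_total gt_order x w.
  exists w => [|w']; rewrite inE ?ws ?orbT // => /predU1P[->//|]; exact: wmax.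
exists x => [|w']; rewrite inE ?eqxx // => /predU1P[->|/wmax le].
  exact: wle_refl.
by left; apply: (wle_lt_trans gt_order le wx).
Qed.

Lemma fil_lead Q f : fil G Q f ->
  f = 0 \/ exists2 w, Q w & fil G (wle gt ^~ w) f.
Proof.
move=> ff; pose s : seq ('X_{1..n} * 'I_r * nat) :=
  [seq gwt G j w | j <- enum 'I_a, w <- msupp ('X_[gdeg G j] * f ord0 j)].
have sP j w : tcoef G f j w != 0 -> (gwt G j w : 'X_{1..n} * 'I_r * nat) \in s.
  rewrite -mcoeff_msupp => jw; apply/allpairsPdep; exists j, w.
  by rewrite mem_enum.
have [s0|/max_weight[w /allpairsPdep[j [u [_ ju ->]]] wmax]] := eqVneq s [::].
  left; apply: tcoef_eq0 => j w; apply/eqP.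
  by apply: contraT => /sP; rewrite s0.
right; exists (gwt G j u); first by apply: ff; rewrite /tcoef -mcoeff_msupp.
by move=> j' w' /sP/wmax.
Qed.

End OneModule.

Section Maps.
Variables (a b : nat) (G : grading a) (G' : grading b) (g : 'M[S]_(a, b)).
Hypothesis hG : homogeneous_wt G.

Lemma fil_mulmx (Q Q' : weight -> Prop) f :
  (forall j u, Q (gwt G j (u + gdeg G j)%MM) -> fil G' Q' ('X_[u] *: row j g)) ->
  fil G Q f -> fil G' Q' (f *m g).
Proof.
move=> row_fil ff; rewrite mulmx_sum_row; apply: fil_sum => j _.
rewrite [f ord0 j]mpolyE big_seq scaler_suml; apply: fil_sum => u.
rewrite mcoeff_msupp => nz; rewrite -mul_mpolyC -scalerA; apply: filC; apply: row_fil; apply: ff.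
by rewrite /tcoef mcoeffXM lem_addl addmK.
Qed.

Lemma fil_mulmx_le w f :
  (forall j, fil G' (wle gt ^~ (gwt G j (gdeg G j))) (row j g)) ->
  fil G (wle gt ^~ w) f -> fil G' (wle gt ^~ w) (f *m g).
Proof.
move=> row_le; apply: fil_mulmx => j u; rewrite hG => le.
by move: (fil_leX (v := u) (row_le j)); apply: fil_sub => w' lt; exact: (wle_trans gt_order lt le).
Qed.

Lemma fil_mulmx_lt w f :
  (forall j, fil G' (wle gt ^~ (gwt G j (gdeg G j))) (row j g)) ->
  fil G (wlt gt ^~ w) f -> fil G' (wlt gt ^~ w) (f *m g).
Proof.
move=> row_le; apply: fil_mulmx => j u; rewrite hG => le.
by move: (fil_leX (v := u) (row_le j)); apply: fil_sub => w' lt; apply: wle_lt_trans lt le.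
Qed.

Lemma fil_mulmx_drop w f :
  (forall j, fil G' (wlt gt ^~ (gwt G j (gdeg G j))) (row j g)) ->
  fil G (wle gt ^~ w) f -> fil G' (wlt gt ^~ w) (f *m g).
Proof.
move=> row_le; apply: fil_mulmx => j u; rewrite hG => le.
by move: (fil_ltX (v := u) (row_le j)); apply: fil_sub => w' lt; apply: wlt_le_trans lt le.
Qed.

(** Surjectivity onto Z that does not lose weight: this is the form of exactness
    that can be deduced from exactness of the leading parts. *)
Definition strict_onto (Z : set 'rV[S]_b) := forall w y, Z y ->
  fil G' (wle gt ^~ w) y -> exists2 x, fil G (wle gt ^~ w) x & y = x *m g.

(** Cancelling the part of highest weight again and again terminates, because
    weights are well founded. *)
Lemma strict_onto_of_lead (Z : set 'rV[S]_b) :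
  (forall y x, Z y -> Z (y - x *m g)) ->
  (forall w y, Z y -> fil G' (wle gt ^~ w) y ->
    exists2 x, fil G (wle gt ^~ w) x & fil G' (wlt gt ^~ w) (y - x *m g)) ->
  strict_onto Z.
Proof.
move=> ZB step; elim/(well_founded_ind (wlt_wf gt_order)) => w IHw y Zy fy.
have [x fx lt] := step w y Zy fy; have Zy' := ZB _ x Zy.
have [y0|[w' lt' fy']] := fil_lead lt.
  by exists x => //; apply/eqP; rewrite -subr_eq0 y0.
have [x' fx' e] := IHw w' lt' _ Zy' fy'.
exists (x + x'); last by rewrite mulmxDl -e addrC subrK.
by apply: filD => //; move: fx'; apply: fil_sub => v le; left; apply: wle_lt_trans le lt'.
Qed.

Variable Z : set 'rV[S]_b.
Hypothesis strZ : strict_onto Z.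

Lemma strict_onto_lt w y : Z y -> fil G' (wlt gt ^~ w) y ->
  exists2 x, fil G (wlt gt ^~ w) x & y = x *m g.
Proof.
move=> Zy /fil_lead[->|[w' lt fy]]; first by exists 0; [apply: fil0|rewrite mul0mx].
have [x fx ->] := strZ Zy fy; exists x => //.
by move: fx; apply: fil_sub => v le; apply: wle_lt_trans le lt.
Qed.

Lemma strict_onto_ex y : Z y -> exists x, y = x *m g.
Proof.
move=> Zy; have [|->|[w _ fy]] := @fil_lead _ G' (fun=> True) y; first by [].
  by exists 0; rewrite mul0mx.
by have [x _ ->] := strZ Zy fy; exists x.
Qed.

End Maps.

End Filtration.

(** * The Koszul complex tensored with a periodic sequence *)

Section Koszul.

Variables (R : comNzRingType) (n : nat).
Implicit Types (T A : {set 'I_n}) (c : nat -> R) (z : {set 'I_n} -> R).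

Definition koszul_sign (q : 'I_n) T : R := (-1) ^+ #|[set p in T | (p < q)%N]|.

(** A family z indexed by sets lists the coordinates, in one multidegree, of an
    element of total degree s in the tensor product of a Koszul complex
    with ... -> R -> R -> R, the maps being multiplications by c: the coordinate
    at T sits in Koszul degree #T, and the rest of the degree is spent on c.
    This is the coordinate at T of the differential of z. *)
Definition koszul_diff c (s : nat) z T : R :=
  \sum_(q | q \notin T) koszul_sign q T * z (q |: T)
  + (-1) ^+ #|T| * c (s - #|T|)%N * z T.

Lemma koszul_signU (p q : 'I_n) T : q \notin T ->
  koszul_sign p (q |: T) = (-1) ^+ (q < p)%N * koszul_sign p T.
Proof.
move=> qT; rewrite /koszul_sign -exprD; congr (_ ^+ _).
have [qp|pq] := boolP (q < p)%N.
  have -> : [set x in q |: T | (x < p)%N] = q |: [set x in T | (x < p)%N].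
    by apply/setP => x; rewrite !inE; case: eqVneq => // ->.
  by rewrite cardsU1 inE (negPf qT).
rewrite add0n; apply: eq_card => x; rewrite !inE.
by case: eqVneq => // ->; rewrite (negPf pq) !andbF.
Qed.

Lemma sum_antisym (P : pred 'I_n) (F : 'I_n -> 'I_n -> R) :
  (forall p q, P p -> P q -> p != q -> F p q = - F q p) ->
  \sum_(q | P q) \sum_(p | P p && (p != q)) F q p = 0.
Proof.
move=> antiF.
have split q : \sum_(p | P p && (p != q)) F q p =
    \sum_(p | P p && (p < q)%N) F q p + \sum_(p | P p && (q < p)%N) F q p.
  rewrite (bigID (fun p : 'I_n => p < q)%N) /=; congr (_ + _);
    apply: eq_bigl => p; rewrite -val_eqE /=;
    by case: (P p) => //=; case: ltngtP.
under eq_bigr do rewrite split.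
rewrite big_split /= [X in _ + X](exchange_big_dep P) /=; last by move=> ? ? ? /andP[].
rewrite -big_split big1 // => q Pq /=.
apply/eqP; rewrite addr_eq0 -sumrN; apply/eqP.
apply: eq_big => p; first by rewrite Pq.
by case/andP=> Pp pq; apply: antiF => //; rewrite -val_eqE gtn_eqF.
Qed.

Lemma koszul_diffK c s z T : (forall t, c t * c t.+1 = 0) -> (#|T| <= s)%N ->
  koszul_diff c s (koszul_diff c s.+1 z) T = 0.
Proof.
move=> cc Ts; rewrite /koszul_diff.
pose F q p := koszul_sign q T * (koszul_sign p (q |: T) * z (p |: (q |: T))).
have -> : \sum_(q | q \notin T) koszul_sign q T *
    (\sum_(p | p \notin q |: T) koszul_sign p (q |: T) * z (p |: (q |: T)) +
     (-1) ^+ #|q |: T| * c (s.+1 - #|q |: T|)%N * z (q |: T)) =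
   - \sum_(q | q \notin T) (-1) ^+ #|T| * c (s - #|T|)%N * (koszul_sign q T * z (q |: T)).
  under eq_bigr do rewrite mulrDr big_distrr.
  rewrite big_split /= -[RHS]add0r; congr (_ + _).
    rewrite -[RHS](@sum_antisym (fun q => q \notin T) F).
      apply: eq_bigr => q qT; apply: eq_bigl => p.
      by rewrite !inE negb_or andbC.
    move=> p q pT qT npq; rewrite /F finset.setUCA !koszul_signU //.
    by move: npq; rewrite -val_eqE /=; case: ltngtP => //= _ _; rewrite expr1 expr0; ring.
  rewrite -sumrN; apply: eq_bigr => q qT; rewrite cardsU1 qT exprS.
  by rewrite subSS; ring.
rewrite mulrDr addrA -big_distrr /= addNr add0r.
rewrite subSn //.
transitivity (c (s - #|T|)%N * c (s - #|T|).+1 * ((-1) ^+ #|T| * (-1) ^+ #|T| * z T)).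
  by ring.
by rewrite cc mul0r.
Qed.

(** Exactness in one multidegree.  If A is nonempty, adjoining its least element
    i0 is a contracting homotopy, so the sequence c is irrelevant; if A is empty
    only the empty set contributes, and exactness is that of the sequence c. *)
Lemma koszul_diff_exact c s A z :
  (forall t x, c t * x = 0 -> exists y, x = c t.+1 * y) ->
  (forall T, z T != 0 -> (T \subset A) && (#|T| <= s)%N) ->
  (forall T, T \subset A -> (#|T| < s)%N -> koszul_diff c s z T = 0) ->
  (A = finset.set0 -> c s * z finset.set0 = 0) ->
  exists2 x : {set 'I_n} -> R,
    forall T, x T != 0 -> (T \subset A) && (#|T| <= s.+1)%N &
    forall T, (#|T| <= s)%N -> koszul_diff c s.+1 x T = z T.
Proof.
move=> annc zA cycle c0.
have z0 T : ~~ ((T \subset A) && (#|T| <= s)%N) -> z T = 0.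
  by move=> nT; apply/eqP; apply: contraNT nT => /zA.
have [A0|[a0 a0A]] := set_0Vmem A.
  have [y yE] := annc s _ (c0 A0).
  exists (fun T => if T == finset.set0 then y else 0) => T.
    by case: (eqVneq T finset.set0) => [->|]; rewrite ?eqxx // finset.sub0set cards0.
  move=> Ts; rewrite /koszul_diff big1 => [|q qT]; last first.
    by case: eqP => [/setP/(_ q)|]; rewrite ?mulr0 // !inE eqxx.
  case: (eqVneq T finset.set0) => [->|nT].
    by rewrite cards0 subn0 expr0 mul1r add0r yE.
  by rewrite mulr0 addr0 z0 // A0 finset.subset0 (negPf nT).
have [i0 i0A i0min] : exists2 i0, i0 \in A & forall q, q \in A -> (i0 <= q)%N.
  by case: (arg_minnP (fun q : 'I_n => val q) a0A) => i ? ?; exists i.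
have sign0 T : T \subset A -> koszul_sign i0 T = 1.
  move=> /fintype.subsetP TA; rewrite /koszul_sign; set B := [set p in T | _].
  suff -> : B = finset.set0 by rewrite cards0.
  apply/setP => p; rewrite !inE; apply/negP => /andP[/TA/i0min le].
  by rewrite ltnNge le.
pose x T : R := if i0 \in T then z (T :\ i0) else 0.
have xA T : x T != 0 -> (T \subset A) && (#|T| <= s.+1)%N.
  rewrite /x; case: ifP => [i0T /zA /andP[TA Ts]|]; last by rewrite eqxx.
  by rewrite -(finset.setD1K i0T) finset.subUset finset.sub1set i0A TA cardsU1 !inE eqxx.
exists x => // T Ts.
have [TA|nTA] := boolP (T \subset A); last first.
  have x0 T' : T \subset T' -> x T' = 0.
    move=> TT'; apply/eqP; apply: contraNT nTA => /xA /andP[T'A _].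
    exact: fintype.subset_trans T'A.
  rewrite /koszul_diff x0 // mulr0 addr0 big1 ?z0 ?(negPf nTA) // => q _.
  by rewrite x0 ?mulr0 // finset.subsetUr.
have [i0T|i0T] := boolP (i0 \in T); last first.
  rewrite /koszul_diff {2}/x (negPf i0T) mulr0 addr0 (bigD1 i0) //= sign0 // mul1r.
  rewrite /x setU11 setU1K // big1 ?addr0 // => q /andP[_ qi].
  by rewrite !inE (negPf i0T) orbF eq_sym (negPf qi) mulr0.
pose T0 := T :\ i0.
have T0E : T = i0 |: T0 by rewrite finset.setD1K.
have i0T0 : i0 \notin T0 by rewrite !inE eqxx.
have cT : #|T| = #|T0|.+1 by rewrite T0E cardsU1 i0T0.
have T0A : T0 \subset A by apply: fintype.subset_trans TA; exact: subD1set.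
have := cycle T0 T0A; rewrite -cT => /(_ Ts).
rewrite {1}/koszul_diff (bigD1 i0) //= sign0 // mul1r -T0E => cyc.
rewrite /koszul_diff {2}/x i0T -/T0 cT subSS exprS.
have -> : \sum_(q | q \notin T) koszul_sign q T * x (q |: T) =
   - \sum_(q | (q \notin T0) && (q != i0)) koszul_sign q T0 * z (q |: T0).
  rewrite -sumrN; apply: eq_big => q.
    by rewrite T0E !inE negb_or andbC; case: eqVneq => // ->; rewrite ?i0T0.
  move=> qT; have ni : q != i0 by apply: contraNneq qT => ->.
  have -> : x (q |: T) = z (q |: T0).
    rewrite /x !inE i0T orbT; congr z; apply/setP => p; rewrite !inE.
    by case: eqVneq => // ->; rewrite eq_sym (negPf ni).
  have [zq|/zA/andP[]] := eqVneq (z (q |: T0)) 0; first by rewrite zq !mulr0 oppr0.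
  rewrite finset.subUset finset.sub1set => /andP[/i0min le _] _.
  rewrite [in LHS]T0E koszul_signU // ltn_neqAle le andbT val_eqE eq_sym ni expr1.
  by rewrite mulN1r mulNr.
by apply/eqP; rewrite -subr_eq0 -oppr_eq0; apply/eqP; rewrite -[RHS]cyc; ring.
Qed.

End Koszul.

(** * The symbol complex *)

Lemma koszul_diff_neq0 (R : comNzRingType) n (c : nat -> R) s
    (z : {set 'I_n} -> R) (T : {set 'I_n}) :
  koszul_diff c s z T != 0 -> exists T', z T' != 0.
Proof.
apply: contra_neqP => nz; have z0 T' : z T' = 0.
  by apply/eqP/negP => /negP zT'; apply: nz; exists T'.
by rewrite /koszul_diff z0 mulr0 addr0 big1 // => q _; rewrite z0 mulr0.
Qed.

Lemma eq_koszul_diff (R : comNzRingType) n (c : nat -> R) s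
    (z z' : {set 'I_n} -> R) (T : {set 'I_n}) :
  (forall q, q \notin T -> z (q |: T) = z' (q |: T)) -> z T = z' T ->
  koszul_diff c s z T = koszul_diff c s z' T.
Proof.
by move=> zq zT; rewrite /koszul_diff zT; congr (_ + _); apply: eq_bigr => q /zq ->.
Qed.

Lemma mcoeff_koszul_diff (R : comNzRingType) n m (c : nat -> R) s
    (z : {set 'I_n} -> {mpoly R[m]}) (T : {set 'I_n}) w :
  (koszul_diff (fun t => (c t)%:MP) s z T)@_w = koszul_diff c s (fun T' => (z T')@_w) T.
Proof.
have signC k : (-1) ^+ k = ((-1) ^+ k)%:MP :> {mpoly R[m]}.
  by rewrite rmorphXn /= mpolyCN mpolyC1.
rewrite /koszul_diff mcoeffD (raddf_sum (mcoeff w)) /=; congr (_ + _).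
  by apply: eq_bigr => q _; rewrite /koszul_sign signC mcoeffCM.
by rewrite signC -mpolyCM mcoeffCM.
Qed.

Section Levels.

Variables (R : comNzRingType) (n r : nat) (gt : rel (fmonom n r)).
Variable D : nat.

Local Notation S := {mpoly R[n]}.

(** The pair (i, v) with v in [0, D]^n stands for the monomials x^w e_i with
    min(w, D) = v. *)
Definition cell : finType := ('I_r * {ffun 'I_n -> 'I_D.+1})%type.
Definition label : finType := (cell * {set 'I_n})%type.

Implicit Types (k : cell) (T : {set 'I_n}) (t : label).

Definition corner k : 'X_{1..n} := [multinom (k.2 q : nat) | q < n].
Definition free_vars k : {set 'I_n} := [set q | (k.2 q < D)%N].
Definition ldeg t : 'X_{1..n} := (corner t.1 + [multinom (q \in t.2 : nat) | q < n])%MM.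
(** Strictly decreasing along a free variable, and equal at w and min(w, D):
    among the corners dividing w, the corner min(w, D) has the least level. *)
Definition level (w : 'X_{1..n}) : nat := (\sum_q (D - w q))%N.
Definition labels (s : nat) : {set label} :=
  [set t : label | (t.2 \subset free_vars t.1) && (#|t.2| <= s)%N].

Definition cell_wt k (w : 'X_{1..n}) : weight n r := (w, k.1, level (corner k)).

Lemma cell_wt_le s (j : 'I_#|labels s|) v w :
  wle gt (cell_wt (enum_val j).1 (v + w)%MM) (wmul v (cell_wt (enum_val j).1 w)).
Proof. exact: wle_refl. Qed.

Definition lgrading s : grading gt #|labels s| :=
  Grading (fun j => ldeg (enum_val j)) (@cell_wt_le s).

Lemma homogeneous_lgrading s : homogeneous_wt (lgrading s).
Proof. by []. Qed.

Definition coord s (f : 'rV[S]_#|labels s|) t : S :=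
  \sum_(j | enum_val j == t) f ord0 j.

(** The homogenised coordinate at t: multiplying by x^(ldeg t) aligns degrees, so
    that symbols act on these coordinates without any monomial factor, one
    multidegree at a time. *)
Definition hcoord s (f : 'rV[S]_#|labels s|) t : S := 'X_[ldeg t] * coord f t.

Lemma coord_enum_val s (f : 'rV[S]_#|labels s|) j : coord f (enum_val j) = f ord0 j.
Proof.
rewrite /coord (bigD1 j) //= big1 ?addr0 // => j' /andP[/eqP/enum_val_inj ->].
by rewrite eqxx.
Qed.

Lemma coord_out s (f : 'rV[S]_#|labels s|) t : t \notin labels s -> coord f t = 0.
Proof.
by move=> nt; rewrite /coord big1 // => j /eqP tE; rewrite -tE enum_valP in nt.
Qed.

Lemma tcoefE s (f : 'rV[S]_#|labels s|) j w :
  tcoef (lgrading s) f j w = (hcoord f (enum_val j))@_w.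
Proof. by rewrite /hcoord coord_enum_val. Qed.

Lemma labels_enum s t : t \in labels s -> exists j : 'I_#|labels s|, t = enum_val j.
Proof. by move=> ts; exists (enum_rank_in ts t); rewrite enum_rankK_in. Qed.

Lemma hcoord_neq0 s (f : 'rV[S]_#|labels s|) t w : (hcoord f t)@_w != 0 ->
  [/\ t.2 \subset free_vars t.1, (#|t.2| <= s)%N & (ldeg t <= w)%MM].
Proof.
have [|nt] := boolP (t \in labels s).
  by rewrite inE => /andP[-> ->]; rewrite /hcoord mcoeffXM; case: ifP => //; rewrite eqxx.
by rewrite /hcoord coord_out // mulr0 mcoeff0 eqxx.
Qed.

Lemma fil_hcoord s (Q : weight n r -> Prop) (f : 'rV[S]_#|labels s|) :
  fil (lgrading s) Q f <-> forall k T w, (hcoord f (k, T))@_w != 0 -> Q (cell_wt k w).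
Proof.
split=> [ff k T w nz|ff j w].
  have kT : (k, T) \in labels s.
    by have [? ? _] := hcoord_neq0 nz; rewrite inE; apply/andP.
  have [j jE] := labels_enum kT; have -> : k = (enum_val j).1 by rewrite -jE.
  by apply: ff; rewrite tcoefE -jE.
rewrite tcoefE -[gwt _ _ _]/(cell_wt (enum_val j).1 w); case: (enum_val j) => k T; exact: ff.
Qed.

Lemma hcoordB s (f h : 'rV[S]_#|labels s|) t : hcoord (f - h) t = hcoord f t - hcoord h t.
Proof.
rewrite /hcoord -mulrBr; congr (_ * _); rewrite /coord -sumrB.
by apply: eq_bigr => j _; rewrite !mxE.
Qed.

Section Symbol.
Variable c : cell -> nat -> R.

Definition symbol s : 'M[S]_(#|labels s.+1|, #|labels s|) :=
  \matrix_(j, j') let t : label := enum_val j in let t' : label := enum_val j' in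
    if t.1 == t'.1 then
      \sum_(q | q \notin t'.2)
        (t.2 == q |: t'.2)%:R * (koszul_sign _ q t'.2 * 'X_q)
      + (t.2 == t'.2)%:R * ((-1) ^+ #|t'.2| * (c t'.1 (s.+1 - #|t'.2|)%N)%:MP)
    else 0.

Lemma ldegU k q T : q \notin T -> ldeg (k, q |: T) = (ldeg (k, T) + U_(q))%MM.
Proof.
move=> qT; rewrite /ldeg /= -addmA; congr (_ + _)%MM; apply/mnmP => p.
rewrite mnmDE !mnmE !inE; have [<-|_] := eqVneq q p; first by rewrite (negPf qT).
by rewrite addn0.
Qed.

Lemma hcoord_symbol s (f : 'rV[S]_#|labels s.+1|) k T : (#|T| <= s)%N ->
  hcoord (f *m symbol s) (k, T) =
  koszul_diff (fun m => (c k m)%:MP) s.+1 (fun T' => hcoord f (k, T')) T.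
Proof.
move=> Ts; have [TF|nTF] := boolP (T \subset free_vars k); last first.
  have out s' (h : 'rV[S]_#|labels s'|) T' : T \subset T' -> hcoord h (k, T') = 0.
    move=> TT'; rewrite /hcoord coord_out ?mulr0 // inE /=.
    by apply: contra nTF => /andP[T'F _]; apply: fintype.subset_trans T'F.
  rewrite out // /koszul_diff out // mulr0 addr0 big1 // => q _.
  by rewrite out ?mulr0 // finset.subsetUr.
have kT : (k, T) \in labels s by rewrite inE TF.
have [j' jE] := labels_enum kT.
have coordE t : coord f t = \sum_j f ord0 j * (enum_val j == t)%:R.
  rewrite /coord big_mkcond /=; apply: eq_bigr => j _.
  by case: eqP; rewrite (mulr1, mulr0).
rewrite /koszul_diff {1 3}/hcoord coordE jE coord_enum_val -jE mxE.
under [in RHS]eq_bigr do rewrite /hcoord coordE !big_distrr /=.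
rewrite exchange_big /= !big_distrr /= -big_split /=; apply: eq_bigr => j _.
rewrite mxE -jE /=; case: (enum_val j) => k' T' /=; rewrite xpair_eqE.
have [->|/negPf nk] /= := eqVneq k' k; last first.
  rewrite !(mulr0, mulr0n) addr0 big1 // => q _.
  by rewrite xpair_eqE nk !(mulr0, mulr0n).
rewrite !mulrDr !big_distrr /=; congr (_ + _); last by ring.
apply: eq_bigr => q qT; rewrite ldegU // mpolyXD xpair_eqE eqxx /=; ring.
Qed.

Lemma fil_symbol s Q (f : 'rV[S]_#|labels s.+1|) :
  fil (lgrading s.+1) Q f -> fil (lgrading s) Q (f *m symbol s).
Proof.
rewrite !fil_hcoord => ff k T w nz; have [_ Ts _] := hcoord_neq0 nz.
move: nz; rewrite hcoord_symbol // mcoeff_koszul_diff.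
by move=> /koszul_diff_neq0[T']; apply: ff.
Qed.

Lemma symbolK s : (forall k m, c k m * c k m.+1 = 0) -> symbol s.+1 *m symbol s = 0.
Proof.
move=> cc; apply/row_matrixP => j; rewrite row_mul row0; set f := row j _.
suff H k T : hcoord (f *m symbol s) (k, T) = 0.
  apply: (@tcoef_eq0 _ _ _ _ _ (lgrading s)) => j' w.
  by rewrite tcoefE; case: (enum_val j') => k T; rewrite H mcoeff0.
have [Ts|] := leqP #|T| s; last first.
  move=> sT; rewrite /hcoord coord_out ?mulr0 // inE /= negb_and -ltnNge sT orbT //.
have fE : f = row j 1%:M *m symbol s.+1 by rewrite -row_mul mul1mx.
rewrite hcoord_symbol // -[RHS](@koszul_diffK _ _ (fun m => (c k m)%:MP) s.+1
  (fun T' => hcoord (row j 1%:M) (k, T')) T); first last.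
- exact: leqW.
- by move=> t; rewrite -mpolyCM cc mpolyC0.
apply: eq_koszul_diff => [q qT|]; rewrite fE hcoord_symbol //; last exact: leqW.
by rewrite cardsU1 qT.
Qed.

(** At one weight (w, i, l) the symbol complex is a sum over the cells k of level
    l of the complexes of koszul_diff_exact, with A the free variables q at k such
    that x_q times the corner of k still divides x^w. *)
Lemma symbol_exact s (y : 'rV[S]_#|labels s|) (i : 'I_r) (w : 'X_{1..n}) l :
  (forall k m x, c k m * x = 0 -> exists y, x = c k m.+1 * y) ->
  fil (lgrading s) (wle gt ^~ (w, i, l)) y ->
  (forall k, k.1 = i -> level (corner k) = l ->
    (forall T, T \subset free_vars k -> (#|T| < s)%N ->
      koszul_diff (c k) s (fun T' => (hcoord y (k, T'))@_w) T = 0) /\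
    ((forall q, (k.2 q < D)%N -> (w q <= k.2 q)%N) ->
      c k s * (hcoord y (k, finset.set0))@_w = 0)) ->
  exists2 x : 'rV[S]_#|labels s.+1|, fil (lgrading s.+1) (wle gt ^~ (w, i, l)) x &
    fil (lgrading s) (wlt gt ^~ (w, i, l)) (y - x *m symbol s).
Proof.
move=> annc fy cyc.
have ex_x k : exists x : {set 'I_n} -> R,
    (forall T, x T != 0 -> [/\ k.1 = i /\ level (corner k) = l,
       (k, T) \in labels s.+1 & (ldeg (k, T) <= w)%MM]) /\
    (k.1 = i -> level (corner k) = l -> forall T, (#|T| <= s)%N ->
       koszul_diff (c k) s.+1 x T = (hcoord y (k, T))@_w).
  pose z T := (hcoord y (k, T))@_w.
  (* If the corner of k does not divide x^w, all coordinates at k vanish. *)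
  have [/and3P[/eqP ki /eqP kl kw]|nk] :=
    boolP [&& k.1 == i, level (corner k) == l & (corner k <= w)%MM]; last first.
    exists (fun=> 0); split=> [T|ki kl T Ts]; first by rewrite eqxx.
    have -> : (hcoord y (k, T))@_w = 0.
      apply/eqP; apply: contraNT nk => /hcoord_neq0[_ _ /mnm_lepP le].
      rewrite ki kl !eqxx; apply/mnm_lepP => q; apply: leq_trans (le q).
      by rewrite mnmDE leq_addr.
    by apply/eqP; apply: contraT => /koszul_diff_neq0[T']; rewrite eqxx.
  have [cyc1 cyc0] := cyc k ki kl.
  pose A : {set 'I_n} := [set q in free_vars k | (k.2 q < w q)%N].
  have AF : A \subset free_vars k by apply/fintype.subsetP => q; rewrite inE => /andP[].
  have [|||x xA xE] := @koszul_diff_exact _ _ (c k) s A z (annc k).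
  - move=> T /hcoord_neq0[/fintype.subsetP TF -> /mnm_lepP le]; rewrite andbT.
    apply/fintype.subsetP => q qT; rewrite inE TF //=; have := le q.
    by rewrite mnmDE !mnmE /= qT addn1.
  - by move=> T TA; apply: cyc1; apply: fintype.subset_trans AF.
  - move=> A0; apply: cyc0 => q qD; rewrite leqNgt; apply/negP => lt.
    by have := finset.in_set0 q; rewrite -A0 !inE qD lt.
  exists x; split=> // T /xA /andP[TA Ts]; split=> //.
    by rewrite inE Ts andbT; apply: fintype.subset_trans AF.
  apply/mnm_lepP => q; rewrite mnmDE !mnmE /=.
  have [qT|_] := boolP (q \in T); last by have /mnm_lepP/(_ q) := kw; rewrite mnmE addn0.
  by move/fintype.subsetP/(_ q qT): TA; rewrite !inE addn1 => /andP[].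
have [x xP] := choice ex_x.
pose X : 'rV[S]_#|labels s.+1| := \row_j
  (let t : label := enum_val j in x t.1 t.2 *: 'X_[(w - ldeg t)%MM]).
have XE k T : hcoord X (k, T) = x k T *: 'X_[w].
  have [kT|kT] := boolP ((k, T) \in labels s.+1); last first.
    have [->|/(xP k).1[_]] := eqVneq (x k T) 0; last by rewrite (negPf kT).
    by rewrite /hcoord coord_out // mulr0 scale0r.
  have [j jE] := labels_enum kT; rewrite /hcoord jE coord_enum_val mxE -jE /=.
  have [->|/(xP k).1[_ _ le]] := eqVneq (x k T) 0; first by rewrite !scale0r mulr0.
  by rewrite -scalerAr -mpolyXD addmC submK.
have fX : fil (lgrading s.+1) (wle gt ^~ (w, i, l)) X.
  apply/fil_hcoord => k T w'; rewrite XE mcoeffZ mcoeffX.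
  have [<-|_] := eqVneq w w'; last by rewrite mulr0 eqxx.
  by rewrite mulr1 => /(xP k).1[[ki kl] _ _]; right; rewrite /cell_wt ki kl.
exists X => //; apply: fil_lt; first by apply: filB => //; apply: fil_symbol.
move=> j u; rewrite tcoefE -[gwt _ _ _]/(cell_wt (enum_val j).1 u) hcoordB.
have := enum_valP j; case: (enum_val j) => k T; rewrite inE => /andP[/= _ Ts].
case=> -> ki kl; rewrite hcoord_symbol // mcoeffB mcoeff_koszul_diff -(xP k).2 //.
apply/eqP; rewrite subr_eq0; apply/eqP; apply: eq_koszul_diff => [q _|];
  by rewrite XE mcoeffZ mcoeffX eqxx mulr1.
Qed.

End Symbol.
End Levels.

(** * Lifting the symbol complex to a resolution *)

Section Resolution.

Variables (R : comNzRingType) (n r : nat) (gt : rel (fmonom n r)).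
Hypothesis gt_order : monomial_order gt.
Variable D : nat.

Local Notation S := {mpoly R[n]}.
Local Notation cell := (cell n r D).
Local Notation labels := (labels n r D).
Local Notation lgrading := (@lgrading n r gt D).
Local Notation level := (level D).

Definition term_row a (j : 'I_a) (v : 'X_{1..n}) (x : R) : 'rV[S]_a :=
  x%:MP *: ('X_[v] *: delta_mx ord0 j).

Lemma term_row_mulmx a b j v x (g : 'M[S]_(a, b)) :
  term_row j v x *m g = x%:MP *: ('X_[v] *: row j g).
Proof. by rewrite /term_row -!scalemxAl -rowE. Qed.

Lemma hcoord_term_row s (j : 'I_#|labels s|) v x t :
  hcoord (term_row j v x) t =
  if t == enum_val j then x *: 'X_[ldeg t + v] else 0.
Proof.
rewrite /hcoord; have [->|nt] := t =P enum_val j.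
  rewrite coord_enum_val !mxE !eqxx mulr1 mpolyXD mulrCA mul_mpolyC.
  by rewrite scalerAr.
have [|nts] := boolP (t \in labels s); last by rewrite coord_out ?mulr0.
move=> /labels_enum[j' jE]; rewrite jE coord_enum_val !mxE eqxx /=.
by case: eqP => [e|_]; [case: nt; rewrite jE e|rewrite !mulr0].
Qed.

Lemma fil_term_row s (j : 'I_#|labels s|) v x :
  fil (lgrading s) (wle gt ^~ (cell_wt (enum_val j).1 (v + ldeg (enum_val j))%MM))
    (term_row j v x).
Proof.
apply/fil_hcoord => k T w; rewrite hcoord_term_row.
have [<-|_] := (k, T) =P enum_val j; last by rewrite mcoeff0 eqxx.
rewrite mcoeffZ mcoeffX addmC.
by have [->|_] := (v + _)%MM =P w; [right|rewrite mulr0 eqxx].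
Qed.

Lemma level_le (v w : 'X_{1..n}) : (v <= w)%MM -> (level w <= level v)%N.
Proof. by move/mnm_lepP=> le; apply: leq_sum => q _; apply: leq_sub2l. Qed.

Lemma gwt0_le (j : 'I_r) (v w : 'X_{1..n}) :
  wle gt ((v + w)%MM, j, level (v + w)%MM) (wmul v (w, j, level w)).
Proof.
have := level_le (lem_addl v w); rewrite leq_eqVlt => /predU1P[->|lt].
  exact: wle_refl.
by left; right.
Qed.

(** F carries the level of min(w, D) at w.  A basis element of the cell k then
    contributes to x^w with a level at least that of x^w, with equality only for
    the cell min(w, D). *)
Definition base_grading : grading gt r := @Grading n r gt r (fun=> 0%MM)
  (fun j w => (w, j, level w)) gwt0_le.

Lemma tcoef_base (f : 'rV[S]_r) j w : tcoef base_grading f j w = fcoeff f (w, j).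
Proof. by rewrite /tcoef /= mpolyX0 mul1r. Qed.

Variable c : cell -> nat -> R.
Hypothesis cc0 : forall k m, c k m * c k m.+1 = 0.
Hypothesis annc : forall k m x, c k m * x = 0 -> exists y, x = c k m.+1 * y.

Local Notation symbol := (symbol c).

Definition rank_at (s : nat) : nat := if s is s'.+1 then #|labels s'| else r.

Definition grading_at (s : nat) : grading gt (rank_at s) :=
  if s is s'.+1 return grading gt (rank_at s) then lgrading s' else base_grading.

(** What is carried along the construction of the maps g.  The last two fields
    say how g interacts with symbols: symbols are cycles up to smaller weight,
    and the top part of a cycle satisfies the hypotheses of symbol_exact. *)
Record good_stage s (g : 'M[S]_(rank_at s.+1, rank_at s))
    (Z : set 'rV[S]_(rank_at s)) : Prop := GoodStage {
  good_le : forall j, fil (grading_at s)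
    (wle gt ^~ (gwt (lgrading s) j (gdeg (lgrading s) j))) (row j g);
  good_im : forall x, Z (x *m g);
  good_strict : strict_onto (lgrading s) (grading_at s) g Z;
  good_next : forall j, fil (grading_at s)
    (wlt gt ^~ (gwt (lgrading s.+1) j (gdeg (lgrading s.+1) j))) (row j (symbol s *m g));
  good_cycle : forall y w i l, y *m g = 0 -> fil (lgrading s) (wle gt ^~ (w, i, l)) y ->
    forall k, k.1 = i -> level (corner k) = l ->
    (forall T : {set 'I_n}, T \subset free_vars k -> (#|T| < s)%N ->
      koszul_diff (c k) s (fun T' => (hcoord y (k, T'))@_w) T = 0) /\
    ((forall q, (k.2 q < D)%N -> (w q <= k.2 q)%N) ->
      c k s * (hcoord y (k, finset.set0))@_w = 0) }.

Lemma fil_row_symbol s j :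
  fil (lgrading s) (wle gt ^~ (gwt (lgrading s.+1) j (gdeg (lgrading s.+1) j)))
    (row j (symbol s)).
Proof.
have -> : row j (symbol s) = term_row j 0 1 *m symbol s.
  by rewrite term_row_mulmx mpolyC1 scale1r mpolyX0 scale1r.
by apply: fil_symbol; have := fil_term_row (v := 0%MM) (j := j) (x := 1); rewrite add0m.
Qed.

(** The differential is the symbol plus terms of smaller weight: the symbol of a
    basis element maps to something of smaller weight, and strictness corrects
    it to a cycle without disturbing the symbol. *)
Lemma good_stage_succ s (g : 'M[S]_(rank_at s.+1, rank_at s)) Z : good_stage g Z ->
  exists g' : 'M[S]_(rank_at s.+2, rank_at s.+1), good_stage g' [set y | y *m g = 0]%classic.
Proof.
move=> [le im strict nxt cyc].
have ex_x j : exists x : 'rV[S]_#|labels s|,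
    fil (lgrading s) (wlt gt ^~ (gwt (lgrading s.+1) j (gdeg (lgrading s.+1) j))) x /\
    row j (symbol s) *m g = x *m g.
  have Zj : Z (row j (symbol s) *m g) by apply: im.
  have := nxt j; rewrite row_mul => lt.
  by have [x fx ->] := strict_onto_lt gt_order strict Zj lt; exists x.
have [x xP] := choice ex_x.
pose X : 'M[S]_(#|labels s.+1|, #|labels s|) := \matrix_j x j.
have rowX j : row j X = x j by rewrite rowK.
have fX := fun w (y : 'rV[S]_#|labels s.+1|) =>
  @fil_mulmx_drop _ _ _ _ gt_order _ _ (lgrading s.+1) (lgrading s) X
    (@homogeneous_lgrading _ _ gt D s.+1) w y (fun j => eq_rect_r _ (xP j).1 (rowX j)).
have g'g : (symbol s - X) *m g = 0.
  by apply/row_matrixP => j; rewrite row0 row_mul linearB /= mulmxBl rowX (xP j).2 subrr.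
exists (symbol s - X); split.
- move=> j; rewrite linearB /= rowX; apply: filB; first exact: fil_row_symbol.
  by move: (xP j).1; apply: fil_sub => w; apply: wltW.
- by move=> y /=; rewrite -mulmxA g'g mulmx0.
- apply: strict_onto_of_lead => // [y z /= yg|w y /= yg fy].
    by rewrite mulmxBl yg -mulmxA g'g mulmx0 subrr.
  case: w fy => -[w i] l fy.
  have [z fz lt] := symbol_exact annc fy (cyc _ _ _ _ yg fy).
  exists z; first exact: fz.
  have -> : y - z *m (symbol s - X) = (y - z *m symbol s) + z *m X.
    by rewrite (mulmxBr z) opprD opprK addrA.
  by apply: filD; [exact: lt|exact: fX].
- move=> j; rewrite mulmxBr symbolK // sub0r -scaleN1r linearZ /= row_mul.
  have -> : -1 = (-1)%:MP :> S by rewrite mpolyCN mpolyC1.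
  by apply: filC; apply: fX; exact: fil_row_symbol.
move=> y w i l yg fy k ki kl.
have cycle (T : {set 'I_n}) : (#|T| < s.+1)%N ->
    koszul_diff (c k) s.+1 (fun T' => (hcoord y (k, T'))@_w) T = 0.
  move=> Ts; rewrite -mcoeff_koszul_diff -hcoord_symbol //.
  have -> : y *m symbol s = y *m X by apply/eqP; rewrite -subr_eq0 -mulmxBr yg.
  apply/eqP; apply: contraT => nz.
  have /fil_hcoord/(_ _ _ _ nz) := fX _ _ fy.
  by rewrite /cell_wt ki kl => /(wlt_irr gt_order).
split=> [T _|wk]; first exact: cycle.
have := cycle finset.set0; rewrite cards0 /koszul_diff cards0 subn0 expr0 mul1r.
rewrite big1 ?add0r => [->//|q _].
(* A nonzero coordinate at the one-element set q would give k.2 q < w q. *)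
suff -> : (hcoord y (k, q |: finset.set0))@_w = 0 by rewrite mulr0.
apply/eqP; apply: contraT => /hcoord_neq0[/= /fintype.subsetP/(_ q) qF _ /mnm_lepP/(_ q)].
move: qF; rewrite mnmDE !mnmE /= setU11 inE addn1 => /(_ isT)/wk.
by rewrite leqNgt => /negPf ->.
Qed.

Definition truncate (w : 'X_{1..n}) : {ffun 'I_n -> 'I_D.+1} :=
  [ffun q => inord (minn (w q) D)].

Lemma truncateE w q : truncate w q = minn (w q) D :> nat.
Proof. by rewrite ffunE inordK // ltnS geq_minr. Qed.

Lemma corner_truncate_le (i : 'I_r) w : (corner (i, truncate w) <= w)%MM.
Proof. by apply/mnm_lepP => q; rewrite mnmE truncateE geq_minl. Qed.

Lemma level_truncate (i : 'I_r) w : level (corner (i, truncate w)) = level w.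
Proof. by apply: eq_bigr => q _; rewrite mnmE truncateE; lia. Qed.

Lemma truncate_unique (k : cell) w :
  (corner k <= w)%MM -> level (corner k) = level w -> k.2 = truncate w.
Proof.
move=> /mnm_lepP le lev; apply/ffunP => q; apply: val_inj; rewrite /= truncateE.
have : (level w <= level (corner k) ?=
    iff [forall q, (D - w q == D - corner k q)%N])%N.
  by apply: leqif_sum => p _; split=> //; apply: leq_sub2l.
case=> _; rewrite lev eqxx => /esym/forallP/(_ q)/eqP.
by have := le q; rewrite mnmE; case: (k.2 q) => x /=; lia.
Qed.

Lemma level_corner_lt (k : cell) q : q \in free_vars k ->
  (level (U_(q) + corner k)%MM < level (corner k))%N.
Proof.
rewrite inE => qD; rewrite /level (bigD1 q) //= [X in (_ < X)%N](bigD1 q) //=.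
rewrite -addSn; apply: leq_add; first by rewrite mnmDE mnm1E eqxx !mnmE; lia.
by apply: leq_sum => p _; rewrite mnmDE; lia.
Qed.

(** The value a = 0 is allowed: then f has only terms below m.  This makes the
    leading coefficients at m an ideal. *)
Definition leads (f : 'rV[S]_r) (m : fmonom n r) (a : R) : Prop :=
  fcoeff f m = a /\ forall m', fcoeff f m' != 0 -> m' = m \/ gt m m'.

Variable U : set 'rV[S]_r.
Hypothesis subU : is_submodule U.
Hypothesis lead_ex : forall k : cell, exists2 f, U f & leads f (corner k, k.1) (c k 0).
Hypothesis lead_dvd : forall f w i a, U f -> leads f (w, i) a ->
  exists b, a = b * c (i, truncate w) 0.

Lemma labels0 (t : label n r D) : t \in labels 0 -> t.2 = finset.set0.
Proof. by rewrite inE leqn0 cards_eq0 => /andP[_ /eqP]. Qed.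

Lemma leads_weight f (k : cell) a (w : fmonom n r) : leads f (corner k, k.1) a ->
  tcoef base_grading f w.2 w.1 != 0 ->
  w = (corner k, k.1) \/ wlt gt (w, level w.1) (cell_wt k (corner k)).
Proof.
by case: w => w i [_ lead]; rewrite tcoef_base => /lead[]; [left|right; left].
Qed.

(** The first map, from the cells onto U.  An element of U whose highest term is
    at x^w e_i is reduced with the cell min(w, D) alone, so no weight is lost.  A
    free variable x_q times the element chosen for the cell (i, v) has smaller
    weight than its basis element, because x_q x^v is still in the box and has a
    smaller level; c_1 times that element has since c_1 a(i, v) = 0. *)
Lemma base_stage : exists g : 'M[S]_(rank_at 1, rank_at 0), good_stage g U.
Proof.
have ex_e (k : cell) : exists f, U f /\ leads f (corner k, k.1) (c k 0).
  by have [f] := lead_ex k; exists f.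
have [e eP] := choice ex_e.
pose g : 'M[S]_(#|labels 0|, r) := \matrix_j e (enum_val j).1.
have rowg j : row j g = e (enum_val j).1 by rewrite rowK.
have [U0 UZD] := subU.
have UD f h : U f -> U h -> U (f + h) by move=> Uf Uh; rewrite -[f]scale1r; apply: UZD.
have UZ (a : S) f : U f -> U (a *: f) by move=> Uf; rewrite -[_ *: _]addr0; apply: UZD.
have Ug x : U (x *m g).
  rewrite mulmx_sum_row; elim/big_rec: _ => // j f _ Uf; apply: UD => //.
  by rewrite rowg; apply/UZ/(eP _).1.
have ldeg0 (t : label n r D) : t \in labels 0 -> ldeg t = corner t.1.
  move=> /labels0 t0; apply/mnmP => q; rewrite /ldeg t0 mnmDE !mnmE inE; exact: addn0.
have le j : fil base_grading (wle gt ^~ (gwt (lgrading 0) j (gdeg (lgrading 0) j))) (row j g).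
  move=> i w nz; rewrite /= ldeg0 ?enum_valP //; move: nz; rewrite rowg.
  case/(leads_weight (w := (w, i)) (eP _).2) => [[-> ->]|]; last exact: wltW.
  exact: wle_refl.
exists g; split => //=.
- apply: strict_onto_of_lead => // [y x Uy|].
    apply: UD => //; rewrite -scaleN1r; exact: UZ.
  move=> -[[w i] l] y Uy fy.
  (* If l is not the level of w, no monomial of F has weight (w, i, l). *)
  have [lw|nlw] := eqVneq (level w) l; last first.
    exists 0; first exact: fil0.
    rewrite mul0mx subr0; apply: fil_lt => // j u [uw _ ul].
    by rewrite -ul uw eqxx in nlw.
  have lead_y : leads y (w, i) (fcoeff y (w, i)).
    split=> // -[w' i']; rewrite -tcoef_base => /fy[[/= ?|[/= -> _]]|[-> -> _]];
      by [left|right].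
  have [b bE] := lead_dvd Uy lead_y.
  pose k : cell := (i, truncate w).
  have kin : (k, finset.set0) \in labels 0 by rewrite inE finset.sub0set cards0.
  have [j jE] := labels_enum kin; have jk : (enum_val j).1 = k by rewrite -jE.
  pose v := (w - corner k)%MM.
  have vE : (v + corner k)%MM = w by apply: submK; apply: corner_truncate_le.
  have fx : fil (lgrading 0) (wle gt ^~ (w, i, l)) (term_row j v b).
    have := @fil_term_row 0 j v b.
    by rewrite ldeg0 ?enum_valP // jk vE /cell_wt level_truncate lw.
  exists (term_row j v b) => //; apply: fil_lt.
    by apply: filB => //; apply: (fil_mulmx_le gt_order) fx.
  move=> i' u [-> -> _]; rewrite tcoefB term_row_mulmx tcoefC tcoefX.
  have -> : (v <= w)%MM by rewrite -vE lem_addr.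
  have -> : (w - v)%MM = corner k by rewrite -vE addmC addmK.
  by rewrite !tcoef_base rowg jk (eP k).2.1 bE subrr.
- move=> j; rewrite row_mul mulmx_sum_row.
  have := enum_valP j; case jE: (enum_val j) => [k T]; rewrite inE /= => /andP[TF Ts].
  apply: fil_sum => j' _; rewrite !mxE jE /=.
  have T'0 := labels0 (enum_valP j').
  have [kE|_] := k =P (enum_val j').1; last by rewrite scale0r; apply: fil0.
  rewrite T'0 rowg -kE scalerDl; apply: filD.
    rewrite scaler_suml; apply: fil_sum => q _.
    have [TE|_] := T =P q |: finset.set0; last by rewrite mul0r scale0r; apply: fil0.
    have -> : koszul_sign S q finset.set0 = 1.
      by rewrite /koszul_sign (_ : [set p in _ | _] = finset.set0) ?cards0 //;
         apply/setP => p; rewrite !inE.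
    have qF : q \in free_vars k by apply: (fintype.subsetP TF); rewrite TE setU11.
    have wtE : cell_wt k (ldeg (k, T)) = ((U_(q) + corner k)%MM, k.1, level (corner k)).
      rewrite /cell_wt /ldeg TE addmC; congr ((_ + _)%MM, _, _); apply/mnmP => p.
      by rewrite mnmE mnm1E finset.setU0 inE eq_sym.
    rewrite !mul1r wtE => i w; rewrite tcoefX; case: ifP => [qw|_]; last by rewrite eqxx.
    case/(leads_weight (w := ((w - U_(q))%MM, i)) (eP k).2) => [e_lead|].
      have /= wE := congr1 fst e_lead; have /= iE := congr1 snd e_lead.
      right; rewrite -(submK qw) wE iE addmC; split=> //=.
      exact: level_corner_lt.
    move=> lt; apply: (wle_lt_trans gt_order
      (b := wmul U_(q) ((w - U_(q))%MM, i, level (w - U_(q))%MM))).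
      by rewrite -{1}(submK qw) addmC; apply: gwt0_le.
    exact: (wlt_mul gt_order _ lt).
  have [TE|_] := T =P finset.set0; last by rewrite mul0r scale0r; apply: fil0.
  have -> : ldeg (k, T) = corner k.
    by apply/mnmP => q; rewrite /ldeg TE mnmDE !mnmE inE; exact: addn0.
  rewrite cards0 expr0 !mul1r subn0 => i w; rewrite tcoefC => nz.
  have nze : tcoef base_grading (e k) i w != 0.
    by apply: contraNneq nz => ->; rewrite mulr0.
  case: (leads_weight (w := (w, i)) (eP k).2 nze) => // e_lead.
  by move: nz; rewrite tcoef_base e_lead (eP k).2.1 mulrC cc0 eqxx.
move=> y w i l yg fy k ki kl; split=> // wk.
set z := (hcoord y (k, finset.set0))@_w.
have [->|nz] := eqVneq z 0; first by rewrite mulr0.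
have [_ _] := hcoord_neq0 nz.
have kin : (k, finset.set0) \in labels 0 by rewrite inE finset.sub0set cards0.
rewrite ldeg0 // => kw; have [j jE] := labels_enum kin.
have lw : level w = l.
  rewrite -kl; apply: eq_bigr => q _; have /mnm_lepP/(_ q) := kw.
  by have := wk q; rewrite mnmE; case: (k.2 q) => x /=; lia.
have kE : k.2 = truncate w by apply: truncate_unique; rewrite ?kl.
pose v := (w - corner k)%MM.
have vE : (v + corner k)%MM = w by apply: submK.
have fx : fil (lgrading 0) (wle gt ^~ (w, i, l)) (term_row j v z).
  have := @fil_term_row 0 j v z.
  by rewrite ldeg0 ?enum_valP // -jE vE /cell_wt ki kl.
(* No other cell has a term of weight (w, i, l), by truncate_unique. *)
have : fil (lgrading 0) (wlt gt ^~ (w, i, l)) (y - term_row j v z).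
  apply: fil_lt; first exact: filB.
  move=> j' u; have := labels0 (enum_valP j'); rewrite tcoefE hcoordB mcoeffB hcoord_term_row.
  rewrite -[gwt _ _ _]/(cell_wt (enum_val j').1 u) -jE.
  case j'E: (enum_val j') => [k' T'] /= -> [-> k'i k'l].
  have [kk'|ne] := (k', finset.set0) =P (k, finset.set0 : {set 'I_n}).
    rewrite kk' -/z mcoeffZ mcoeffX ldeg0 // addmC vE eqxx mulr1 subrr //.
  rewrite mcoeff0 subr0; apply/eqP; apply: contraT => nz'.
  have [_ _ kw'] := hcoord_neq0 nz'.
  have k'in : (k', finset.set0) \in labels 0 by rewrite inE finset.sub0set cards0.
  rewrite ldeg0 // in kw'; case: ne; congr (_, _).
  rewrite (surjective_pairing k') (surjective_pairing k) k'i ki kE.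
  by rewrite (truncate_unique kw') // k'l lw.
move/(fil_mulmx_lt gt_order (@homogeneous_lgrading _ _ gt D 0) le).
rewrite mulmxBl yg sub0r => lt.
apply/eqP; apply: contraT => nzc.
suff /lt : tcoef base_grading (- (term_row j v z *m g)) i w != 0.
  by rewrite /= lw => /(wlt_irr gt_order).
rewrite -sub0r tcoefB tcoef0 sub0r oppr_eq0 term_row_mulmx tcoefC tcoefX.
have -> : (v <= w)%MM by rewrite -vE lem_addr.
have -> : (w - v)%MM = corner k by rewrite -vE addmC addmK.
by rewrite tcoef_base rowg -jE -ki (eP k).2.1 mulrC.
Qed.

Lemma free_resolution_matrices :
  exists g : forall s, 'M[S]_(rank_at s.+1, rank_at s),
    (forall y, U y <-> exists x, y = x *m g 0%N) /\
    forall s (y : 'rV[S]_(rank_at s.+1)), y *m g s = 0 <-> exists x, y = x *m g s.+1.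
Proof.
pose stage s := {gZ : 'M[S]_(rank_at s.+1, rank_at s) * set 'rV[S]_(rank_at s) |
  good_stage gZ.1 gZ.2}.
have nextP s (st : stage s) : {st' : stage s.+1 |
    (sval st').2 = [set y | y *m (sval st).1 = 0]%classic}.
  apply: cid; case: st => -[g Z] /= gZ; have [g' g'Z] := good_stage_succ gZ.
  by exists (exist _ (g', [set y | y *m g = 0]%classic) g'Z).
have [g0 g0U] := cid base_stage.
pose st : forall s, stage s :=
  nat_rect stage (exist _ (g0, U) g0U) (fun s st => sval (nextP s st)).
have imP s y : (sval (st s)).2 y <-> exists x, y = x *m (sval (st s)).1.
  have gZ := svalP (st s); split; last by move=> [x ->]; apply: good_im gZ x.
  exact: strict_onto_ex (good_strict gZ) y.
exists (fun s => (sval (st s)).1); split=> [y|s y]; first by rewrite -imP.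
by rewrite -imP /= (svalP (nextP s (st s))).
Qed.

End Resolution.

(** * Leading coefficients of a module with finitely generated LT *)

Section LeadingCoefficients.

Variables (R : comNzRingType) (n r : nat) (gt : rel (fmonom n r)).
Hypothesis gt_order : monomial_order gt.

Local Notation S := {mpoly R[n]}.
Local Notation F := 'rV[S]_r.

Definition ideal_set (I : set R) : Prop :=
  I 0 /\ forall a x y, I x -> I y -> I (a * x + y).

Definition bezout : Prop := forall x y : R, exists d u v s t,
  [/\ d = u * x + v * y, x = s * d & y = t * d].

Definition principal_annihilators : Prop := forall x : R, exists y,
  x * y = 0 /\ forall z, x * z = 0 -> exists t, z = y * t.

Lemma bezout_seq (s : seq R) : bezout -> exists d,
  (forall x, x \in s -> exists a, x = a * d) /\
  forall I, ideal_set I -> (forall x, x \in s -> I x) -> I d.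
Proof.
move=> bez; elim: s => [|x s [e [se eI]]].
  by exists 0; split=> // I [].
have [d [u [v [a [b [dE xE eE]]]]]] := bez x e.
exists d; split=> [z|I idI Is].
  rewrite inE => /predU1P[->|/se[c ->]]; first by exists a.
  by exists (c * b); rewrite eE mulrA.
have Ix : I x by apply: Is; rewrite mem_head.
have Ie : I e by apply: eI => // z zs; apply: Is; rewrite inE zs orbT.
have [I0 Ilin] := idI; rewrite dE; apply: (Ilin) => //.
by have := Ilin v e 0 Ie I0; rewrite addr0.
Qed.

Lemma fcoeffD (f h : F) m : fcoeff (f + h) m = fcoeff f m + fcoeff h m.
Proof. by rewrite /fcoeff mxE mcoeffD. Qed.

Lemma fcoeffZ (p : S) (f : F) w i : fcoeff (p *: f) (w, i) =
  \sum_(v <- msupp p) p@_v * (if (v <= w)%MM then fcoeff f ((w - v)%MM, i) else 0).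
Proof.
rewrite /fcoeff mxE {1}[p]mpolyE big_distrl raddf_sum /=; apply: eq_bigr => v _.
by rewrite -scalerAl mcoeffZ mcoeffXM.
Qed.

Lemma fcoeff_fterm (a : R) (m m' : fmonom n r) :
  fcoeff (fterm a m) m' = if m == m' then a else 0.
Proof.
case: m m' => u i [v j]; rewrite /fcoeff /fterm !mxE eqxx /= xpair_eqE andbC eq_sym.
case: eqP => _ /=; last by rewrite mulr0 mcoeff0.
by rewrite mulr1 mcoeffZ mcoeffX; case: eqP; rewrite (mulr1, mulr0).
Qed.

(** Used for the ideals of leading coefficients of U and for the ideals generated
    by the a(k): each yields a submodule containing the generators of LT(U), hence
    containing LT(U). *)
Lemma coeff_ideals_submodule (J : fmonom n r -> set R) :
  (forall m, ideal_set (J m)) ->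
  (forall v m a, J m a -> J (fmonom_mul v m) a) ->
  is_submodule [set f : F | forall m, J m (fcoeff f m)]%classic.
Proof.
move=> idJ Jmul; split=> [m|p f h Jf Jh [w i]].
  by rewrite /fcoeff mxE mcoeff0; case: (idJ m).
have [J0 Jlin] := idJ (w, i); rewrite fcoeffD fcoeffZ.
elim/big_rec: _ => [|v a _ Ja]; first by rewrite add0r.
rewrite -addrA; apply: Jlin => //; case: ifP => // vw.
by have := Jmul v _ _ (Jf ((w - v)%MM, i)); rewrite /fmonom_mul /= addmC submK.
Qed.

Lemma mem_fsupp (f : F) m : (m \in fsupp f) = (fcoeff f m != 0).
Proof.
case: m => u i; rewrite -mcoeff_msupp; apply/allpairsPdep/idP.
  by case=> j [v [_ vf [-> ->]]].
by move=> uf; exists i, u; rewrite mem_enum.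
Qed.

Lemma leads_LT (f : F) m a : leads gt f m a -> a != 0 -> LT gt f = fterm a m.
Proof.
have [[irr tr _] _] := gt_order; move=> [<- lead] nz.
have mf : m \in fsupp f by rewrite mem_fsupp.
have allm : all (fun m' => (m' == m) || gt m m') (fsupp f).
  by apply/allP => m'; rewrite mem_fsupp => /lead[->|->]; rewrite ?eqxx ?orbT.
rewrite /LT /lead_monom; case sE: [seq _ <- _ | _] => [|m0 s] /=.
  by have := in_nil m; rewrite -sE mem_filter mf allm.
have : m0 \in [seq x <- fsupp f | all (fun m' => (m' == x) || gt x m') (fsupp f)].
  by rewrite sE mem_head.
rewrite mem_filter => /andP[/allP/(_ _ mf)/predU1P[-> //|gt0] m0f].
have := allP allm _ m0f => /predU1P[-> //|gt1].
by exfalso; have := tr _ _ _ gt1 gt0; rewrite irr.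
Qed.

Lemma LT_leads (f : F) m : fcoeff (LT gt f) m != 0 -> leads gt f m (fcoeff (LT gt f) m).
Proof.
rewrite /LT /lead_monom; case sE: [seq _ <- _ | _] => [|m0 s] /=.
  by rewrite /fcoeff mxE mcoeff0 eqxx.
have : m0 \in [seq x <- fsupp f | all (fun m' => (m' == x) || gt x m') (fsupp f)].
  by rewrite sE mem_head.
rewrite mem_filter fcoeff_fterm => /andP[/allP lead m0f].
have [<- _|_] := m0 =P m.
  by split=> // m'; rewrite -mem_fsupp => /lead/predU1P.
by rewrite eqxx.
Qed.

Variable U : set F.
Hypothesis subU : is_submodule U.

Definition lead_coefs (m : fmonom n r) : set R :=
  [set a | exists2 f, U f & leads gt f m a]%classic.

Lemma lead_coefs_ideal m : ideal_set (lead_coefs m).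
Proof.
have [U0 UZD] := subU; split.
  by exists 0 => //; split=> [|m']; rewrite /fcoeff mxE mcoeff0 ?eqxx.
case: m => w i a x y [f Uf [fx leadf]] [h Uh [hy leadh]].
have coefE w' i' : fcoeff (a%:MP *: f + h) (w', i') = a * fcoeff f (w', i') + fcoeff h (w', i').
  by rewrite fcoeffD /fcoeff mxE mcoeffCM.
exists (a%:MP *: f + h); first exact: UZD.
split=> [|[w' i']]; first by rewrite coefE fx hy.
rewrite coefE; have [->|nz _] := eqVneq (fcoeff f (w', i')) 0; last exact: leadf.
by rewrite mulr0 add0r => /leadh.
Qed.

Lemma lead_coefs_mul v m a : lead_coefs m a -> lead_coefs (fmonom_mul v m) a.
Proof.
have [_ [_ mulmono]] := gt_order; have [U0 UZD] := subU.
case: m => w i [f Uf [fa lead]].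
have coefE w' i' : fcoeff ('X_[v] *: f) (w', i') =
    if (v <= w')%MM then fcoeff f ((w' - v)%MM, i') else 0.
  by rewrite /fcoeff mxE mcoeffXM.
exists ('X_[v] *: f); first by rewrite -[_ *: _]addr0; apply: UZD.
split=> [|[w' i']]; rewrite coefE /=; first by rewrite lem_addr addmC addmK.
case: ifP => [vw|_]; last by rewrite eqxx.
have -> : (w', i') = fmonom_mul v ((w' - v)%MM, i') by rewrite /fmonom_mul addmC submK.
by move=> /lead[->|/(mulmono v)]; [left|right].
Qed.

Lemma LT_submodule_coef (f : F) m : LT_submodule gt U f -> lead_coefs m (fcoeff f m).
Proof.
move=> /(_ _ (conj (coeff_ideals_submodule lead_coefs_ideal lead_coefs_mul) _)).
apply=> _ [h Uh <-] m' /=.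
have [->|nz] := eqVneq (fcoeff (LT gt h) m') 0; first by case: (lead_coefs_ideal m').
by exists h => //; apply: LT_leads.
Qed.

Lemma coef_bound (s : seq F) : exists D, forall h m, h \in s -> fcoeff h m != 0 ->
  forall q, (m.1 q <= D)%N.
Proof.
exists (\max_(h <- s) \max_i msize (h ord0 i)) => h [w i] hs nz q.
apply: leq_trans (_ : mdeg w <= _)%N; first by rewrite mdegE (bigD1 q) //= leq_addr.
have /msize_mdeg_lt/ltnW le : w \in msupp (h ord0 i) by rewrite mcoeff_msupp.
apply: leq_trans le _; apply: leq_trans (leq_bigmax_seq (P := xpredT) _ hs isT).
exact: leq_bigmax.
Qed.

(** A uniform bound D on the exponents of generators of LT(U) makes the ideal
    of leading coefficients at w depend on min(w, D) only. *)
Lemma groebner_data : bezout -> fin_gen (LT_submodule gt U) ->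
  exists D (a : cell n r D -> R),
    (forall k, lead_coefs (corner k, k.1) (a k)) /\
    forall w i x, lead_coefs (w, i) x -> exists b, x = b * a (i, truncate D w).
Proof.
move=> bez [s LTs]; have [D boundD] := coef_bound s; exists D.
pose L (k : cell n r D) : seq R :=
  [seq fcoeff h (v, k.1) | h <- s, v <- [seq v <- msupp (h ord0 k.1) | (v <= corner k)%MM]].
have [a aP] := choice (fun k => bezout_seq (L k) bez).
have sLT h : h \in s -> LT_submodule gt U h.
  by move=> hs; rewrite LTs => V [_]; apply.
exists a; split=> [k|w i x [f Uf lead]].
  apply: (aP k).2; first exact: lead_coefs_ideal.
  move=> x /allpairsPdep[h [v [hs]]]; rewrite mem_filter => /andP[vk _] ->.
  have := lead_coefs_mul (corner k - v)%MM (LT_submodule_coef (v, k.1) (sLT h hs)).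
  by rewrite /fmonom_mul submK.
have [->|nz] := eqVneq x 0; first by exists 0; rewrite mul0r.
pose J (m : fmonom n r) : set R := [set x | exists b, x = b * a (m.2, truncate D m.1)]%classic.
have idJ m : ideal_set (J m).
  split=> [|c y z [b ->] [b' ->]]; first by exists 0; rewrite mul0r.
  by exists (c * b + b'); rewrite mulrDl mulrA.
have Jmul v m y : J m y -> J (fmonom_mul v m) y.
  case: m => u j [b ->]; suff [b' ->] : J (fmonom_mul v (u, j)) (a (j, truncate D u)).
    by exists (b * b'); rewrite mulrA.
  apply: (aP _).2 => // z /allpairsPdep[h [v' [hs]]]; rewrite mem_filter => /andP[le vh] ->.
  apply: (aP _).1; apply/allpairsPdep; exists h, v'; split=> //.
  rewrite mem_filter vh andbT; apply: lepm_trans le _; apply/mnm_lepP => q.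
  by rewrite !mnmE /= !truncateE mnmDE; lia.
have Js h : h \in s -> forall m, J m (fcoeff h m).
  move=> hs [u j]; have [->|nzh] := eqVneq (fcoeff h (u, j)) 0; first by case: (idJ (u, j)).
  apply: (aP _).1; apply/allpairsPdep; exists h, u; split=> //.
  rewrite mem_filter mcoeff_msupp nzh andbT; apply/mnm_lepP => q.
  by rewrite mnmE truncateE; have /= := boundD h _ hs nzh q; lia.
have : LT_submodule gt U (fterm x (w, i)).
  by move=> V [_ LTV]; apply: LTV; exists f => //; apply: leads_LT lead nz.
rewrite LTs => /(_ _ (conj (coeff_ideals_submodule idJ Jmul) Js)) /(_ (w, i)).
by rewrite fcoeff_fterm eqxx.
Qed.

End LeadingCoefficients.

(** * The coefficient ring *)

Section Coefficients.

Lemma submodule_gen1 (D : idomainType) (a x : D^o) :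
  submodule_gen [set a]%classic x <-> exists y : D, x = y * a.
Proof.
split=> [|[y ->] V [[V0 VZD] Va]]; last first.
  have /(_ y a 0 (Va a erefl) V0) := VZD; rewrite addr0; exact.
move/(_ [set z : D^o | exists y : D, z = y * a]%classic); apply; split=> /=.
  split=> [|b u v [y ->] [z ->]]; first by exists 0; rewrite mul0r.
  by exists (b * y + z); rewrite mulrDl -mulrA.
by move=> _ ->; exists 1; rewrite mul1r.
Qed.

Variables (D : idomainType) (pidD : is_pid D) (N : D) (hN : N \isn't a GRing.unit).

Local Notation Q := (quot_ring hN).

Definition residue (x : D) : Q := (\pi_({ideal_quot (pr_ideal hN)}) x)%qT.

Lemma residue_surj (q : Q) : exists x, q = residue x.
Proof. by exists (repr q); rewrite /residue reprK. Qed.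

Lemma residueM x y : residue (x * y) = residue x * residue y.
Proof. by rewrite /residue rmorphM. Qed.

Lemma residueD x y : residue (x + y) = residue x + residue y.
Proof. by rewrite /residue rmorphD. Qed.

Lemma residue_eq0 x : residue x = 0 <-> exists y, x = N * y.
Proof.
rewrite -[0](rmorph0 (\pi_({ideal_quot (pr_ideal hN)})%qT)) /residue.
split=> [/eqP|Nx]; last apply/eqP;
  rewrite -(Quotient.idealrBE (pr_ideal hN)) subr0.
  by move/asboolP.
exact/asboolP.
Qed.

Lemma quot_ring_bezout : bezout Q.
Proof.
move=> p q; have [x ->] := residue_surj p; have [y ->] := residue_surj q.
pose I : set D^o := [set z : D^o | exists u v : D, z = u * x + v * y]%classic.
have [|d dE] := pidD (I := I).
  split=> [|a s t [u [v ->]] [u' [v' ->]]]; first by exists 0, 0; rewrite !mul0r addr0.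
  by exists (a * u + u'), (a * v + v'); rewrite !mulrDl -!mulrA addrACA -mulrDr.
have dI z : I z <-> exists t : D, z = t * d by rewrite dE submodule_gen1.
have [u [v duv]] : I d by apply/dI; exists 1; rewrite mul1r.
have /dI[s xE] : I x by exists 1, 0; rewrite mul1r mul0r addr0.
have /dI[t yE] : I y by exists 0, 1; rewrite mul1r mul0r add0r.
exists (residue d), (residue u), (residue v), (residue s), (residue t).
by split; rewrite -!residueM -?residueD; congr residue.
Qed.

(** The annihilator of the class of x is the image of the ideal (N : x), which is
    principal in D. *)
Lemma quot_ring_annihilators : principal_annihilators Q.
Proof.
move=> p; have [x ->] := residue_surj p.
pose I : set D^o := [set z : D^o | exists y : D, x * z = N * y]%classic.
have [|d dE] := pidD (I := I).
  split=> [|a s t [y sE] [y' tE]]; first by exists 0; rewrite !mulr0.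
  by exists (a * y + y'); rewrite -[a *: s]/(a * s) !mulrDr tE mulrCA sE [in RHS]mulrCA.
have dI z : I z <-> exists t : D, z = t * d by rewrite dE submodule_gen1.
exists (residue d); split=> [|q].
  by rewrite -residueM; apply/residue_eq0/dI; exists 1; rewrite mul1r.
have [z ->] := residue_surj q; rewrite -residueM => /residue_eq0/dI[t ->].
by exists (residue t); rewrite residueM mulrC.
Qed.

End Coefficients.

Section Products.

Variables (A : Type) (infA : infinite_set [set: A]%classic) (Q : A -> comNzRingType).

Lemma prod_ring_bezout : (forall i, bezout (Q i)) -> bezout (prod_ring infA Q).
Proof.
move=> bez x y.
have data i : {w : (Q i * (Q i * Q i)) * (Q i * Q i) |
    [/\ w.1.1 = w.1.2.1 * x i + w.1.2.2 * y i, x i = w.2.1 * w.1.1 & y i = w.2.2 * w.1.1]}.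
  by apply: cid; have [d [u [v [s [t H]]]]] := bez i (x i) (y i); exists ((d, (u, v)), (s, t)).
pose w i := sval (data i).
exists (fun i => (w i).1.1), (fun i => (w i).1.2.1), (fun i => (w i).1.2.2),
  (fun i => (w i).2.1), (fun i => (w i).2.2).
by split; apply: prod_ext => i; case: (svalP (data i)).
Qed.

Lemma prod_ring_annihilators :
  (forall i, principal_annihilators (Q i)) ->
  principal_annihilators (prod_ring infA Q).
Proof.
move=> ann x; pose y i := sval (cid (ann i (x i))).
have yP i := svalP (cid (ann i (x i))).
exists y; split=> [|z xz]; first by apply: prod_ext => i; exact: (yP i).1.
have z_ex i : {t | z i = y i * t}.
  by apply/cid/(yP i).2; have := congr1 (fun f : prod_ring infA Q => f i) xz.
by exists (fun i => sval (z_ex i)); apply: prod_ext => i; exact: svalP (z_ex i).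
Qed.

End Products.

(** * The resolution *)

Section Assembly.

Variables (R : comNzRingType) (n r : nat) (gt : rel (fmonom n r)).

Local Notation S := {mpoly R[n]}.

Lemma free_resolution_of_groebner (M : lmodType S) (U : set 'rV[S]_r)
    (hU : is_submodule U) :
  bezout R -> principal_annihilators R ->
  (exists f : {linear M -> quot_mod hU}, bijective f) ->
  monomial_order gt -> fin_gen (LT_submodule gt U) ->
  free_resolution_stable_from M n.+1.
Proof.
move=> bez ann [f [f' fK f'K]] gt_order fgLT.
have [D [a [lead_ex lead_dvd]]] := groebner_data gt_order hU bez fgLT.
have [nxt nxtP] := choice ann.
pose c (k : cell n r D) (m : nat) := iter m nxt (a k).
have cc0 k m : c k m * c k m.+1 = 0 by exact: (nxtP (c k m)).1.
have annc k m x : c k m * x = 0 -> exists y, x = c k m.+1 * y by exact: (nxtP (c k m)).2.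
have [g [gU gK]] := free_resolution_matrices gt_order cc0 annc hU lead_ex
  (fun h w i x Uh lead => lead_dvd w i x (ex_intro2 _ _ h Uh lead)).
pose pi (v : 'rV[S]_r) : quot_mod hU := (\pi_(Quotient.quot (submod_pred hU)) v)%qT.
have pi_lin : linear pi.
  by move=> p u v; rewrite /pi -Defs.pi_add -Defs.pi_scale.
have f'_lin : linear f'.
  by move=> p u v; apply: (can_inj fK); rewrite f'K linearP !f'K.
have e_lin : linear (f' \o pi) by move=> p u v; rewrite /= pi_lin f'_lin.
pose e : {linear 'rV[S]_(rank_at n r D 0) -> M} :=
  HB.pack (f' \o pi) (GRing.isLinear.Build _ _ _ _ (f' \o pi) e_lin).
have f'0 : f' 0 = 0 by rewrite -[0 in LHS](raddf0 f) fK.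
have kerE v : (f' \o pi) v = 0 <-> U v.
  have piE : pi v = 0 <-> U v.
    rewrite -[0](raddf0 (\pi_(Quotient.quot (submod_pred hU)))%qT).
    split=> [/eqP|Uv]; last apply/eqP;
      rewrite -(Quotient.idealrBE (submod_pred hU)) subr0.
      by move/submod_predP.
    exact/submod_predP.
  rewrite -piE /=; split=> [e0|-> //].
  by rewrite -[pi v]f'K e0 raddf0.
exists (rank_at n r D), e, (fun j => mulmxr (g j)); split.
- case=> [//|j nj]; apply: eq_card => t; rewrite !inE.
  have Tn : (#|t.2| <= n)%N by rewrite -[X in (_ <= X)%N]card_ord max_card.
  by rewrite Tn (leq_trans Tn nj).
- apply/seteqP; split=> // x _; have [v vE] := quot_mod_surj (f x).
  by exists v => //=; rewrite /pi -vE fK.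
- apply/seteqP; split=> [_ [x _ <-]|v /= /kerE/gU[x ->]]; last by exists x.
  by apply/kerE/gU; exists x.
move=> j; apply/seteqP; split=> [_ [x _ <-]|v /= /gK[x ->]] /=; last by exists x.
by apply/gK; exists x.
Qed.

End Assembly.

Local Open Scope classical_set_scope.

Theorem theorem6p8
  (A : Type) (infA : infinite_set [set: A])
  (D : A -> idomainType) (pidD : forall i, is_pid (D i))
  (N : forall i, D i) (hN : forall i, N i \isn't a GRing.unit)
  (n : nat)
  (M : lmodType {mpoly (prod_ring infA (fun i => quot_ring (hN i)))[n]})
  (fgM : fin_gen [set: M])
  (r : nat)
  (U : set 'rV[{mpoly (prod_ring infA (fun i => quot_ring (hN i)))[n]}]_r) (hU : is_submodule U)
  (isoM : exists f : {linear M -> quot_mod hU}, bijective f)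
  (gt : rel (fmonom n r)) (gt_order : monomial_order gt)
  (fgLT : fin_gen (LT_submodule gt U)) :
  exists2 p : nat, (p <= n.+1)%N & free_resolution_stable_from M p.
Proof.
exists n.+1 => //; apply: free_resolution_of_groebner isoM gt_order fgLT.
  exact: (prod_ring_bezout (fun i => quot_ring_bezout (pidD i) (hN := hN i))).
exact: (prod_ring_annihilators (fun i => quot_ring_annihilators (pidD i) (hN := hN i))).
Qed.
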